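(* Let $\mathcal N$ be a $*$-subalgebra of $\mathcal B(\mathcal H)$ with $\mathcal N\neq\mathbb C\mathbb I$ and $\mathcal N\neq\mathcal B(\mathcal H)$, let $E_{\mathcal N}$ be a conditional expectation onto $\mathcal N$ such that $\sigma_{\mathrm{Tr}}:=E_{\mathcal N*}(\mathbb I/d_{\mathcal H})$ is full rank, and consider the Lindbladian $\mathcal L_{\mathcal N}:=E_{\mathcal N}-\mathrm{id}$. If $\alpha\ge0$ is such that $\alpha\,\mathrm{Ent}_{2,\mathcal N}(X)\le\mathcal E_{2,\mathcal L_{\mathcal N}}(X)$ for all positive semidefinite $X\in\mathcal B(\mathcal H)$, then $\alpha=0$.
   Context: $\mathcal H$ is a finite-dimensional complex Hilbert space of dimension $d_{\mathcal H}$. A conditional expectation onto $\mathcal N$ is a unital completely positive projection $E_{\mathcal N}:\mathcal B(\mathcal H)\to\mathcal N$ with $E_{\mathcal N}[AXB]=AE_{\mathcal N}[X]B$ for $A,B\in\mathcal N$; $E_{\mathcal N*}$ is its predual ($\mathrm{Tr}[E_{\mathcal N*}(X)Y]=\mathrm{Tr}[XE_{\mathcal N}[Y]]$). Put $\Gamma^s(X)=\sigma_{\mathrm{Tr}}^{s/2}X\sigma_{\mathrm{Tr}}^{s/2}$ and $\langle X,Y\rangle_{\sigma_{\mathrm{Tr}}}=\mathrm{Tr}[\sigma_{\mathrm{Tr}}^{1/2}X^*\sigma_{\mathrm{Tr}}^{1/2}Y]$. Dirichlet form: $\mathcal E_{2,\mathcal L_{\mathcal N}}(X)=-\langle X,\mathcal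 L_{\mathcal N}(X)\rangle_{\sigma_{\mathrm{Tr}}}$. Entropy: with $Z=\Gamma^{1/2}(X)$, $\mathrm{Ent}_{2,\mathcal N}(X)=\mathrm{Tr}\big[Z^2\big(\ln Z-\frac12\ln E_{\mathcal N}[\sigma_{\mathrm{Tr}}^{-1/2}Z^2\sigma_{\mathrm{Tr}}^{-1/2}]-\frac12\ln\sigma_{\mathrm{Tr}}\big)\big]$ (with the convention $0\ln0=0$). *)

(* Defs.v *)
From HB Require Import structures.
From mathcomp Require Import all_boot all_order all_algebra.
From mathcomp Require Import reals exp.
From mathcomp Require Import complex.
Set Implicit Arguments. Unset Strict Implicit. Unset Printing Implicit Defensive.
Import Order.TTheory GRing.Theory Num.Theory.
Local Open Scope ring_scope.

Section QDefs.
Context {R : realType}.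
Local Notation C := R[i].

Definition adjmx m n (A : 'M[C]_(m, n)) : 'M[C]_(n, m) := map_mx Num.conj (trmx A).

Definition psdmx n (A : 'M[C]_n) : Prop :=
  forall v : 'rV[C]_n, 0 <= (v *m A *m adjmx v) 0 0.

(* Functional calculus for normal (in particular Hermitian) matrices, via the
   spectral decomposition A = P^-1 diag(lambda) P with P unitary; f is applied
   to the real parts of the eigenvalues (which are real for Hermitian A). *)
Definition mxfun (f : R -> R) n (A : 'M[C]_n) : 'M[C]_n :=
  invmx (spectralmx A)
  *m diag_mx (map_mx (fun z : C => ((f (complex.Re z))%:C)%C) (spectral_diag A))
  *m spectralmx A.

Definition mxpowR (s : R) n (A : 'M[C]_n) : 'M[C]_n := mxfun (fun x => x `^ s) A.

(* matrix logarithm (with the convention ln 0 = 0 of mathcomp-analysis, i.e.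
   log taken on the support) *)
Definition mxln n (A : 'M[C]_n) : 'M[C]_n := mxfun (@ln R) A.

Definition star_subalgebra n (N : 'M[C]_n -> Prop) : Prop :=
  [/\ N 1%:M,
      (forall (a : C) A B, N A -> N B -> N (a *: A + B)),
      (forall A B, N A -> N B -> N (A *m B)) &
      (forall A, N A -> N (adjmx A))].

Definition completely_positive n (E : 'M[C]_n -> 'M[C]_n) : Prop :=
  forall (k : nat) (X : 'I_k -> 'I_k -> 'M[C]_n),
    psdmx (\mxblock_(i < k, j < k) X i j) ->
    psdmx (\mxblock_(i < k, j < k) E (X i j)).

Definition cond_expectation n (N : 'M[C]_n -> Prop) (E : 'M[C]_n -> 'M[C]_n)
  : Prop :=
  [/\ (forall (a : C) X Y, E (a *: X + Y) = a *: E X + E Y),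
      E 1%:M = 1%:M,
      completely_positive E,
      (forall X, N (E X)) /\ (forall A, N A -> E A = A) &
      (forall A B X, N A -> N B -> E (A *m X *m B) = A *m E X *m B)].

(* Predual E_* : Tr[E_*(X) Y] = Tr[X E[Y]] for all Y (unique such map). *)
Definition predual n (E : 'M[C]_n -> 'M[C]_n) (X : 'M[C]_n) : 'M[C]_n :=
  \matrix_(i, j) \tr (X *m E (delta_mx j i)).

Definition Gammamx n (sigma : 'M[C]_n) (s : R) (X : 'M[C]_n) : 'M[C]_n :=
  mxpowR (s / 2) sigma *m X *m mxpowR (s / 2) sigma.

Definition sigma_inner n (sigma : 'M[C]_n) (X Y : 'M[C]_n) : C :=
  \tr (mxpowR (1 / 2) sigma *m adjmx X *m mxpowR (1 / 2) sigma *m Y).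

Definition lindbladian n (E : 'M[C]_n -> 'M[C]_n) (X : 'M[C]_n) : 'M[C]_n :=
  E X - X.

Definition dirichlet2 n (sigma : 'M[C]_n) (L : 'M[C]_n -> 'M[C]_n)
  (X : 'M[C]_n) : C :=
  - sigma_inner sigma X (L X).

Definition ent2 n (sigma : 'M[C]_n) (E : 'M[C]_n -> 'M[C]_n) (X : 'M[C]_n) : C :=
  let Z := Gammamx sigma (1 / 2) X in
  \tr ((Z *m Z) *m
       (mxln Z
        - (1 / 2 : C) *: mxln (E (mxpowR (- (1 / 2)) sigma *m (Z *m Z)
                                   *m mxpowR (- (1 / 2)) sigma))
        - (1 / 2 : C) *: mxln sigma)).

End QDefs.

(* Main.v *)
(* The failure comes from matrices near a noninvertible element of N.  Let p be
   a nontrivial projection of N, q = 1 - p, and let Y = q Y p be nonzero with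
   E Y = 0; such a Y exists because a subalgebra containing p and both
   off-diagonal corners is everything.  Along a curve X_t = p + O(t) whose first
   order term is built from Y and its adjoint, the Dirichlet form is O(t^2), since
   it is a quadratic form vanishing on N.  The conditional expectation
   omega_t in the entropy equals p + O(t^2) and carries mass of order t^2 under q,
   where its eigenvalues are themselves of order t^2; this contributes
   c t^2 ln(1/t) with c > 0 to the entropy, while all the other terms are bounded
   below by - C t^2.  Letting t tend to 0 forces alpha = 0. *)
Require Import Defs.
From HB Require Import structures.
From mathcomp Require Import all_boot all_order all_algebra.
From mathcomp Require Import reals exp.
From mathcomp Require Import complex.
From mathcomp Require Import boolp sequences ring lra.
Set Implicit Arguments. Unset Strict Implicit. Unset Printing Implicit Defensive.
Import Order.TTheory GRing.Theory Num.Theory.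
Local Open Scope ring_scope.

(** No logarithm is expanded in [t], because the eigenvectors of [Z t] and [w t] (the operator
    called omega_t above) are not controlled. Each logarithm is replaced by a bound whose trace is
    polynomial. Klein's inequality handles [ln Z] and [ln s] together. For [ln w] the majorant is
    [(w - 1) - L (w - 1)^2] plus a quartic error, with [L = - ln t]; since [w - 1] is [- q] to
    leading order, its square carries the divergence. Errors multiplied by [L] must therefore be of
    order [t^3], as only [L t <= 1] is available. The curve is prescribed through
    [Z = Gamma^(1/2)(X)], equal to [S p + t (U + adjmx U) + t^2 B] with [S = s^(1/2)] and [U = S Y].
    With this [U], the first-order part of the argument of [E] is [Y + adjmx Y], which [E] kills. An
    off-diagonal first-order term spoils positivity by itself: the summand [U S^-1 adjmx U] of [B]
    completes a square, and its other summand, the identity, gives [Z >= t^2], so that [w t] is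
    invertible for [t > 0]. The constant in front of the divergence comes from the trace of
    [U (adjmx U)]. *)

Section Spectral.
Context {R : realType}.
Local Notation C := R[i].

(** * Adjoints and functional calculus in an eigenbasis *)

Lemma adjmxM m n k (A : 'M[C]_(m, n)) (B : 'M[C]_(n, k)) :
  adjmx (A *m B) = adjmx B *m adjmx A.
Proof. by rewrite /adjmx trmx_mul map_mxM. Qed.

Lemma adjmxD m n (A B : 'M[C]_(m, n)) : adjmx (A + B) = adjmx A + adjmx B.
Proof. by apply/matrixP=> i j; rewrite !mxE rmorphD. Qed.

Lemma adjmxN m n (A : 'M[C]_(m, n)) : adjmx (- A) = - adjmx A.
Proof. by apply/matrixP=> i j; rewrite !mxE rmorphN. Qed.

Lemma adjmxZ m n (a : C) (A : 'M[C]_(m, n)) :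
  adjmx (a *: A) = Num.conj a *: adjmx A.
Proof. by apply/matrixP=> i j; rewrite !mxE rmorphM. Qed.

Lemma adjmxK m n (A : 'M[C]_(m, n)) : adjmx (adjmx A) = A.
Proof. by apply/matrixP=> i j; rewrite !mxE conjCK. Qed.

Lemma adjmx1 n : adjmx (1%:M : 'M[C]_n) = 1%:M.
Proof. by rewrite /adjmx trmx1 map_mx1. Qed.

Lemma adjmx_row m n (A : 'M[C]_(m, n)) i : adjmx (row i A) = col i (adjmx A).
Proof. by apply/matrixP=> k j; rewrite !mxE. Qed.

Lemma conj_realC (a : R) : Num.conj (a%:C)%C = (a%:C)%C :> C.
Proof. exact: conjc_real. Qed.

Lemma realCM (a b : R) : ((a * b)%:C)%C = (a%:C)%C * (b%:C)%C :> C.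
Proof. exact: rmorphM. Qed.

Lemma realC_sum I (r : seq I) (F : I -> R) :
  ((\sum_(i <- r) F i)%:C)%C = \sum_(i <- r) ((F i)%:C)%C :> C.
Proof. exact: rmorph_sum. Qed.

Lemma ReD (x y : C) : complex.Re (x + y) = complex.Re x + complex.Re y.
Proof. by case: x; case: y. Qed.

Lemma ReN (x : C) : complex.Re (- x) = - complex.Re x.
Proof. by case: x. Qed.

Lemma ReZ (a : R) (x : C) : complex.Re ((a%:C)%C * x) = a * complex.Re x.
Proof. by case: x => x y /=; rewrite mul0r subr0. Qed.

Lemma ReXM (t : R) k (z : C) :
  complex.Re ((t%:C)%C ^+ k * z) = t ^+ k * complex.Re z.
Proof. by rewrite -rmorphXn; exact: ReZ. Qed.

Lemma quad_diag n (P A : 'M[C]_n) k :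
  (row k P *m A *m adjmx (row k P)) 0 0 = (P *m A *m adjmx P) k k.
Proof. by rewrite -row_mul adjmx_row !mxE; apply: eq_bigr => j _; rewrite !mxE. Qed.

Lemma spectral_adj n (A : 'M[C]_n) : invmx (spectralmx A) = adjmx (spectralmx A).
Proof. by rewrite invmx_unitary ?spectral_unitarymx. Qed.

Lemma spectral_mulV n (A : 'M[C]_n) : spectralmx A *m adjmx (spectralmx A) = 1%:M.
Proof. by rewrite -spectral_adj mulmxV ?spectral_unit. Qed.

Lemma spectral_mulVl n (A : 'M[C]_n) : adjmx (spectralmx A) *m spectralmx A = 1%:M.
Proof. by rewrite -spectral_adj mulVmx ?spectral_unit. Qed.

Definition eigval n (A : 'M[C]_n) (k : 'I_n) : R :=
  complex.Re (spectral_diag A 0 k).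

Lemma mxfunE n (f : R -> R) (A : 'M[C]_n) :
  mxfun f A = adjmx (spectralmx A)
    *m diag_mx (\row_k (f (eigval A k))%:C%C) *m spectralmx A.
Proof.
rewrite /mxfun spectral_adj; congr (_ *m diag_mx _ *m _).
by apply/rowP => k; rewrite !mxE.
Qed.

Lemma mxfun_diag n (f : R -> R) (A : 'M[C]_n) :
  spectralmx A *m mxfun f A *m adjmx (spectralmx A) =
  diag_mx (\row_k (f (eigval A k))%:C%C).
Proof.
by rewrite mxfunE !mulmxA spectral_mulV mul1mx -mulmxA spectral_mulV mulmx1.
Qed.

Lemma eq_mxfun n (f g : R -> R) (A : 'M[C]_n) :
  (forall k, f (eigval A k) = g (eigval A k)) -> mxfun f A = mxfun g A.
Proof.
by move=> fg; rewrite !mxfunE; congr (_ *m diag_mx _ *m _);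
   apply/rowP=> k; rewrite !mxE fg.
Qed.

Lemma mxfunM n (f g : R -> R) (A : 'M[C]_n) :
  mxfun f A *m mxfun g A = mxfun (fun x => f x * g x) A.
Proof.
rewrite !mxfunE -!mulmxA [spectralmx A *m (_ *m _)]mulmxA spectral_mulV mul1mx.
congr (_ *m _); rewrite !mulmxA; congr (_ *m _); rewrite mulmx_diag.
by congr diag_mx; apply/rowP=> k; rewrite !mxE rmorphM.
Qed.

Lemma mxfunD n (f g : R -> R) (A : 'M[C]_n) :
  mxfun f A + mxfun g A = mxfun (fun x => f x + g x) A.
Proof.
rewrite !mxfunE -mulmxDl -mulmxDr -linearD /=; congr (_ *m diag_mx _ *m _).
by apply/rowP=> k; rewrite !mxE rmorphD.
Qed.

Lemma mxfunZ n (a : R) (f : R -> R) (A : 'M[C]_n) :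
  (a%:C)%C *: mxfun f A = mxfun (fun x => a * f x) A.
Proof.
rewrite !mxfunE scalemxAl scalemxAr -linearZ /=; congr (_ *m diag_mx _ *m _).
by apply/rowP=> k; rewrite !mxE rmorphM.
Qed.

Lemma mxfun_cst n (a : R) (A : 'M[C]_n) : mxfun (fun=> a) A = (a%:C)%C%:M.
Proof.
rewrite mxfunE; have -> : \row_(k < n) (a%:C)%C = const_mx (a%:C)%C :> 'rV[C]_n.
  by apply/rowP=> k; rewrite !mxE.
by rewrite diag_const_mx -mulmxA mul_scalar_mx -scalemxAr spectral_mulVl scalemx1.
Qed.

Lemma mxfun_adj n (f : R -> R) (A : 'M[C]_n) : adjmx (mxfun f A) = mxfun f A.
Proof.
rewrite !mxfunE !adjmxM adjmxK mulmxA; congr (_ *m _ *m _).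
apply/matrixP => i j; rewrite !mxE eq_sym; case: eqVneq => [->|_].
  by rewrite !mulr1n conj_realC.
by rewrite !mulr0n conjC0.
Qed.

Lemma herm_normal n (A : 'M[C]_n) : adjmx A = A -> A \is normalmx.
Proof. by move=> hA; apply/normalmxP; rewrite -[map_mx _ _]/(adjmx A) hA. Qed.

Lemma herm_eigval n (A : 'M[C]_n) k : adjmx A = A ->
  spectral_diag A 0 k = (eigval A k)%:C%C.
Proof.
move=> hA; rewrite /eigval RRe_real //.
have : A \is hermsymmx.
  by rewrite is_hermitianmxE expr0 scale1r -[map_mx _ _]/(adjmx A) hA.
by move/hermitian_spectral_diag_real/mxOverP/(_ 0 k).
Qed.

Lemma mxfun_id n (A : 'M[C]_n) : adjmx A = A -> mxfun id A = A.
Proof.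
move=> hA; have := orthomx_spectralP (herm_normal hA); rewrite mxfunE spectral_adj.
have -> : spectral_diag A = \row_k (eigval A k)%:C%C.
  by apply/rowP=> k; rewrite !mxE herm_eigval.
by move/esym.
Qed.

Lemma eigval_quad n (A : 'M[C]_n) k : adjmx A = A ->
  (eigval A k)%:C%C = (spectralmx A *m A *m adjmx (spectralmx A)) k k.
Proof.
by move=> hA; rewrite -{3}(mxfun_id hA) mxfun_diag !mxE eqxx.
Qed.

(** In an eigenbasis of [A], commutation says [(a i - a j) * M i j = 0], so [f (a i) = f (a j)]
    wherever [M i j] is nonzero. *)
Lemma mxfun_comm n (f : R -> R) (A B : 'M[C]_n) : adjmx A = A ->
  A *m B = B *m A -> mxfun f A *m B = B *m mxfun f A.
Proof.
move=> hA; rewrite -{1 2}(mxfun_id hA) !mxfunE.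
move: (spectralmx A) (spectral_mulV A) (spectral_mulVl A) => P PV VP.
move: (eigval A) => a AB; set M := P *m B *m adjmx P.
have {}AB : diag_mx (\row_k (a k)%:C%C) *m M = M *m diag_mx (\row_k (a k)%:C%C).
  move/(congr1 (fun X => P *m X *m adjmx P)) : AB.
  rewrite /M !mulmxA PV mul1mx => ->.
  by rewrite -[_ *m P *m adjmx P]mulmxA PV mulmx1.
have fM : diag_mx (\row_k (f (a k))%:C%C) *m M
          = M *m diag_mx (\row_k (f (a k))%:C%C).
  apply/matrixP => i j; move/matrixP/(_ i j): AB; move: M => M.
  rewrite !mul_diag_mx !mul_mx_diag !mxE [LHS]mulrC => /eqP.
  rewrite -subr_eq0 -mulrBr mulf_eq0.
  case/orP => [/eqP ->|]; first by rewrite mul0r mulr0.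
  by rewrite subr_eq0 => /eqP/complexI ->; rewrite mulrC.
move/(congr1 (fun X => adjmx P *m X *m P)): fM; rewrite /M !mulmxA.
by rewrite VP mul1mx -[_ *m adjmx P *m P]mulmxA VP mulmx1.
Qed.

(** The weights are the squared moduli of the overlaps between the two eigenbases. They depend on
    neither [f] nor [g], so a trace inequality reduces to a scalar inequality for each pair of
    eigenvalues. *)
Lemma tr_mxfun2 n (A B : 'M[C]_n) :
  exists2 m : 'I_n -> 'I_n -> R, forall i j, 0 <= m i j &
  forall f g, \tr (mxfun f A *m mxfun g B) =
    (\sum_i \sum_j f (eigval A i) * g (eigval B j) * m i j)%:C%C.
Proof.
set P := spectralmx A; set Q := spectralmx B; set M := P *m adjmx Q.
exists (fun i j => complex.Re (M i j * Num.conj (M i j))).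
  by move=> i j; have := mul_conjC_ge0 (M i j); rewrite lecE => /andP[].
move=> f g; rewrite !mxfunE -/P -/Q.
set F := diag_mx _; set G := diag_mx _.
have -> : \tr (adjmx P *m F *m P *m (adjmx Q *m G *m Q))
        = \tr (F *m M *m (G *m adjmx M)).
  by rewrite /M adjmxM adjmxK -!mulmxA mxtrace_mulC -!mulmxA.
rewrite /F /G {F G}; move: M => M.
rewrite /mxtrace realC_sum; apply: eq_bigr => i _.
rewrite mxE realC_sum; apply: eq_bigr => j _.
rewrite !mul_diag_mx !mxE !realCM RRe_real; first by ring.
by rewrite ger0_real // mul_conjC_ge0.
Qed.

End Spectral.

(** * Positive semidefinite matrices and trace inequalities *)

Section Psd.
Context {R : realType}.
Local Notation C := R[i].

Lemma psdmx_conj m n (T : 'M[C]_(m, n)) (B : 'M[C]_n) :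
  psdmx B -> psdmx (T *m B *m adjmx T).
Proof. by move=> hB v; have := hB (v *m T); rewrite adjmxM !mulmxA. Qed.

Lemma psdmx_diag n (d : 'rV[C]_n) :
  (forall k, 0 <= d 0 k) -> psdmx (diag_mx d).
Proof.
move=> hd v; rewrite !mxE sumr_ge0 // => k _.
rewrite mul_mx_diag !mxE mulrAC mulrC mulr_ge0 ?mul_conjC_ge0 //.
Qed.

Lemma psdmxD n (A B : 'M[C]_n) : psdmx A -> psdmx B -> psdmx (A + B).
Proof.
by move=> hA hB v; rewrite mulmxDr mulmxDl mxE addr_ge0.
Qed.

Lemma psdmx_scalar n (c : R) : 0 <= c -> psdmx ((c%:C)%C%:M : 'M[C]_n).
Proof.
by move=> c0; rewrite -diag_const_mx; apply: psdmx_diag => k; rewrite mxE ler0c.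
Qed.

(** A complex number that is [>= 0] is real, so the Hermitian matrix ['i *: (A - adjmx A)] has zero
    quadratic form; its eigenvalues vanish, hence so does the matrix. *)
Lemma psdmx_herm n (A : 'M[C]_n) : psdmx A -> adjmx A = A.
Proof.
move=> hA; pose B := 'i *: (A - adjmx A).
have hB : adjmx B = B.
  by rewrite /B adjmxZ adjmxD adjmxN adjmxK conjCi scaleNr -scalerN opprB.
suff : B = 0.
  by move/eqP; rewrite scaler_eq0 (negPf (neq0Ci _)) /= subr_eq0 => /eqP.
rewrite -(mxfun_id hB) (@eq_mxfun _ _ id (fun=> 0)).
  by rewrite mxfun_cst raddf0.
move=> k; apply: complexI; rewrite eigval_quad // -quad_diag.
set v := row _ _; rewrite /B -scalemxAr -scalemxAl mulmxBr mulmxBl.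
have -> : v *m adjmx A *m adjmx v = adjmx (v *m A *m adjmx v).
  by rewrite !adjmxM adjmxK mulmxA.
have := hA v; move: (v *m A *m adjmx v) => x /ger0_real/CrealP x00.
by rewrite !mxE x00 subrr mulr0.
Qed.

Lemma psdmx_tr_ge0 n (A : 'M[C]_n) : psdmx A -> 0 <= \tr A.
Proof.
move=> hA; apply: sumr_ge0 => k _.
by have := hA (row k 1%:M); rewrite quad_diag adjmx1 mul1mx mulmx1.
Qed.

Lemma eigval_ge n (c : R) (A : 'M[C]_n) k :
  psdmx (A - (c%:C)%C%:M) -> c <= eigval A k.
Proof.
move=> hA; have hAA : adjmx A = A.
  have := psdmx_herm hA; rewrite adjmxD adjmxN -scalemx1 adjmxZ adjmx1 conj_realC.
  by move/addIr.
have := hA (row k (spectralmx A)); rewrite quad_diag mulmxBr mulmxBl.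
rewrite mul_mx_scalar -scalemxAl spectral_mulV.
move: (eigval_quad k hAA); move: (_ *m A *m _) => M e.
by rewrite !mxE -e eqxx mulr1 subr_ge0 lecR.
Qed.

Lemma eigval_ge0 n (A : 'M[C]_n) k : psdmx A -> 0 <= eigval A k.
Proof. by move=> hA; apply: eigval_ge; rewrite raddf0 subr0. Qed.

Lemma psdmx_mxfun n (f : R -> R) (A : 'M[C]_n) :
  (forall k, 0 <= f (eigval A k)) -> psdmx (mxfun f A).
Proof.
move=> hf; rewrite mxfunE -{2}[spectralmx A]adjmxK; apply: psdmx_conj.
by apply: psdmx_diag => k; rewrite mxE ler0c.
Qed.

Lemma eigval_gt0 n (A : 'M[C]_n) k : psdmx A -> A \in unitmx -> 0 < eigval A k.
Proof.
move=> hA uA; rewrite lt_def eigval_ge0 // andbT.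
have hAA := psdmx_herm hA.
have : diag_mx (\row_k (eigval A k)%:C%C) \in unitmx.
  rewrite -(mxfun_diag id) mxfun_id // !unitmx_mul uA spectral_unit /=.
  by rewrite -spectral_adj unitmx_inv spectral_unit.
rewrite unitmxE det_diag unitfE => /prodf_neq0/(_ k isT).
by rewrite mxE; apply: contra_neq => ->.
Qed.

Lemma mxpowRD n (A : 'M[C]_n) (r s : R) : psdmx A -> A \in unitmx ->
  mxpowR r A *m mxpowR s A = mxpowR (r + s) A.
Proof.
move=> hA uA; rewrite mxfunM; apply: eq_mxfun => k.
by rewrite powRD //; apply/implyP => _; rewrite gt_eqF // eigval_gt0.
Qed.

Lemma mxpowR0 n (A : 'M[C]_n) : mxpowR 0 A = 1%:M.
Proof.
by rewrite -[1%:M](mxfun_cst 1 A); apply: eq_mxfun => k; rewrite powRr0.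
Qed.

Lemma unit_psdmx_gap n (A : 'M[C]_n) : psdmx A -> A \in unitmx ->
  exists2 c : R, 0 < c & psdmx (A - (c%:C)%C%:M).
Proof.
move=> hA uA; have [c c0 hc] : exists2 c : R, 0 < c & forall k, c <= eigval A k.
  (* The default 1 keeps the minimum positive when there is no eigenvalue at all. *)
  exists (\big[Num.min/1]_k eigval A k).
    by elim/big_ind: _ => // [x y x0 y0|k _]; rewrite ?lt_min ?x0 ?eigval_gt0.
  by move=> k; rewrite (bigD1 k) //= ge_min lexx.
exists c => //; rewrite -(mxfun_cst c A) -{1}(mxfun_id (psdmx_herm hA)).
rewrite -scaleN1r; have -> : (-1 : C) = ((-1)%:C)%C by rewrite rmorphN.
rewrite mxfunZ mxfunD; apply: psdmx_mxfun => k.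
by rewrite mulN1r subr_ge0.
Qed.

Lemma gap_unitmx n (c : R) (A : 'M[C]_n) : 0 < c ->
  psdmx (A - (c%:C)%C%:M) -> A \in unitmx.
Proof.
move=> c0 hA; have hAA : psdmx A.
  rewrite -(subrK (c%:C)%C%:M A); apply: psdmxD => //.
  exact/psdmx_scalar/ltW.
suff /mulmx1_unit[] : A *m mxfun GRing.inv A = 1%:M by [].
rewrite -{1}(mxfun_id (psdmx_herm hAA)) mxfunM -[RHS](mxfun_cst 1 A).
apply: eq_mxfun => k; rewrite mulfV // gt_eqF //.
exact: lt_le_trans (eigval_ge _ hA).
Qed.

Lemma unitary_entry_le n (A : 'M[C]_n) k i : `|spectralmx A k i| <= 1.
Proof.
have /matrixP/(_ k k) := spectral_mulV A; rewrite !mxE eqxx => e.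
rewrite -(expr_le1 (n := 2)) // -[leRHS]e (bigD1 i) //= !mxE -normCK lerDl.
by apply: sumr_ge0 => j _; rewrite !mxE mul_conjC_ge0.
Qed.

(** The bound does not involve [A]: it stays uniform along a family whose eigenbasis varies in an
    uncontrolled way. *)
Lemma spectral_diag_bound n (A M : 'M[C]_n) k :
  `|(spectralmx A *m M *m adjmx (spectralmx A)) k k| <=
  \sum_i \sum_j `|M i j|.
Proof.
rewrite mxE; apply: le_trans (ler_norm_sum _ _ _) _.
rewrite [leRHS]exchange_big; apply: ler_sum => j _.
rewrite normrM !mxE norm_conjC.
apply: (@le_trans _ _ `|\sum_j0 spectralmx A k j0 * M j0 j|).
  by rewrite ler_piMr // unitary_entry_le.
apply: le_trans (ler_norm_sum _ _ _) _; apply: ler_sum => i _.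
by rewrite normrM ler_piMl // unitary_entry_le.
Qed.

Lemma mul_mxfun_sqr n (A : 'M[C]_n) : adjmx A = A ->
  A *m A = mxfun (fun x => x * x) A.
Proof. by move=> hA; rewrite -{1 2}(mxfun_id hA) mxfunM. Qed.

(* Klein's inequality, from the scalar bound [ln (x / y) >= 1 - y / x]. *)
Lemma klein n (Z s : 'M[C]_n) : psdmx Z -> psdmx s -> s \in unitmx ->
  complex.Re (\tr (Z *m Z)) - complex.Re (\tr (Z *m mxpowR (1 / 2) s)) <=
  complex.Re (\tr (Z *m Z *m mxln Z)) -
  2^-1 * complex.Re (\tr (Z *m Z *m mxln s)).
Proof.
move=> hZ hs us; have hZZ := psdmx_herm hZ.
have [m m0 trE] := tr_mxfun2 Z s.
have [one sqr] : mxfun (fun=> 1) s = 1%:M /\ Z *m Z = mxfun (fun x => x * x) Z.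
  by split; [exact: mxfun_cst|exact: mul_mxfun_sqr].
have e1 := trE (fun x => x * x) (fun=> 1); rewrite one mulmx1 -sqr in e1.
have e2 := trE id (fun x => x `^ (1 / 2)); rewrite (mxfun_id hZZ) in e2.
have e3 := trE (fun x => x * x * @ln R x) (fun=> 1).
rewrite one mulmx1 -mxfunM -sqr in e3.
have e4 := trE (fun x => x * x) (@ln R); rewrite -sqr in e4.
pose S f g : C :=
  (\sum_i \sum_j f (eigval Z i) * g (eigval s j) * m i j)%:C%C.
suff key a b c d : a = S (fun x => x * x) (fun=> 1) ->
    b = S id (fun x => x `^ (1 / 2)) ->
    c = S (fun x => x * x * ln x) (fun=> 1) -> d = S (fun x => x * x) (@ln R) ->
    complex.Re a - complex.Re b <= complex.Re c - 2^-1 * complex.Re d.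
  exact: (key _ _ _ _ e1 e2 e3 e4).
move=> {e1 e2 e3 e4 trE one sqr} -> -> -> -> /=; rewrite {}/S /=.
rewrite -subr_ge0 mulr_sumr -!sumrB; apply: sumr_ge0 => i _.
rewrite mulr_sumr -!sumrB; apply: sumr_ge0 => j _.
have := m0 i j; have := eigval_ge0 i hZ; have := eigval_gt0 j hs us.
move: (eigval s j) (eigval Z i) (m i j) => y x w y0 x0 w0.
set r := y `^ (1 / 2).
have r0 : 0 < r by apply: powR_gt0.
have lr : ln y = 2 * ln r by rewrite /r ln_powR; lra.
(* With [r] the square root of [y], the weighted summand has this form; the outer factor [x]
   disposes of a zero eigenvalue of [Z]. *)
suff h : 0 <= x * (x * ln x - x * ln r - x + r).
  by have := mulr_ge0 h w0; rewrite lr; lra.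
move: x0; rewrite le_eqVlt => /orP[/eqP <-|x0]; first by rewrite mul0r.
apply: mulr_ge0; first exact: ltW.
have : ln (r / x) <= r / x - 1.
  have := @le_ln1Dx R (r / x - 1); rewrite [1 + _]addrC subrK; apply.
  by rewrite ltrBrDr addNr divr_gt0.
rewrite ln_div // -(ler_pM2l x0) => h.
have e : x * (r / x - 1) = r - x by field; rewrite gt_eqF.
by move: h; rewrite e; lra.
Qed.

(** The weights of [tr_mxfun2] and the squared eigenvalues of [Z] are nonnegative. Only the spectrum
    of [w] matters, which lets a polynomial replace the logarithm of [w]. *)
Lemma tr_sqr_mxfun_le n (Z w : 'M[C]_n) (f g : R -> R) : psdmx Z ->
  (forall k, f (eigval w k) <= g (eigval w k)) ->
  complex.Re (\tr (Z *m Z *m mxfun f w)) <= complex.Re (\tr (Z *m Z *m mxfun g w)).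
Proof.
move=> hZ fg; have [m m0 trE] := tr_mxfun2 Z w.
rewrite (mul_mxfun_sqr (psdmx_herm hZ)).
have key (x y : C) (u v : R) : x = (u%:C)%C -> y = (v%:C)%C -> u <= v ->
    complex.Re x <= complex.Re y by move=> -> ->.
apply: (key _ _ _ _ (trE _ f) (trE _ g)).
apply: ler_sum => i _; apply: ler_sum => j _.
by rewrite ler_wpM2r // ler_wpM2l // -expr2 sqr_ge0.
Qed.

End Psd.

(** * Unital positive linear maps *)

Section LinearPositive.
Context {R : realType}.
Local Notation C := R[i].
Variables (n : nat) (E : 'M[C]_n -> 'M[C]_n).

Hypothesis Elin : forall (a : C) X Y, E (a *: X + Y) = a *: E X + E Y.

Lemma linE0 : E 0 = 0.
Proof.
have := Elin 1 0 0; rewrite !scale1r addr0 => /eqP.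
by rewrite -subr_eq subrr => /eqP.
Qed.

Lemma linED X Y : E (X + Y) = E X + E Y.
Proof. by have := Elin 1 X Y; rewrite !scale1r. Qed.

Lemma linEZ a X : E (a *: X) = a *: E X.
Proof. by have := Elin a X 0; rewrite linE0 !addr0. Qed.

Lemma linEN X : E (- X) = - E X.
Proof. by rewrite -scaleN1r linEZ scaleN1r. Qed.

Lemma linE_sum I (r : seq I) (F : I -> 'M[C]_n) :
  E (\sum_(i <- r) F i) = \sum_(i <- r) E (F i).
Proof. exact: (big_morph E linED linE0). Qed.

Lemma linE_delta X : E X = \sum_i \sum_j X i j *: E (delta_mx i j).
Proof.
rewrite {1}[X]matrix_sum_delta linE_sum; apply: eq_bigr => i _.
by rewrite linE_sum; apply: eq_bigr => j _; rewrite linEZ.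
Qed.

Lemma predualE X Y : \tr (predual E X *m Y) = \tr (X *m E Y).
Proof.
rewrite linE_delta mulmx_sumr raddf_sum /=.
transitivity (\sum_i \sum_j predual E X i j * Y j i).
  by apply: eq_bigr => i _; rewrite mxE.
rewrite exchange_big; apply: eq_bigr => i _.
rewrite mulmx_sumr raddf_sum; apply: eq_bigr => j _.
by rewrite -scalemxAr /= mxtraceZ mxE mulrC.
Qed.

Hypothesis Epos : forall X, psdmx X -> psdmx (E X).
Hypothesis E1 : E 1%:M = 1%:M.

(** Polarization against the identity writes [X] through [(1 + X)^2], [1] and [X^2], and squares of
    Hermitian matrices are positive semidefinite. *)
Lemma linE_herm X : adjmx X = X -> adjmx (E X) = E X.
Proof.
move=> hX; have psq A : adjmx A = A -> adjmx (E (A *m A)) = E (A *m A).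
  move=> hA; apply/psdmx_herm/Epos.
  rewrite -{2}hA -[A in A *m _]mulmx1; apply: psdmx_conj.
  exact: (@psdmx_scalar R n 1 ler01).
have e : E X = 2^-1 *: (E ((1%:M + X) *m (1%:M + X)) - 1%:M - E (X *m X)).
  have -> : (1%:M + X) *m (1%:M + X) = 1%:M + 2 *: X + X *m X.
    by rewrite mulmxDl !mulmxDr !mul1mx mulmx1 !addrA scaler_nat mulr2n addrA.
  rewrite !linED linEZ E1 addrAC [1%:M + _]addrC !addrK.
  by rewrite scalerA mulVf ?pnatr_eq0 // scale1r.
have h1X : adjmx (1%:M + X) = 1%:M + X by rewrite adjmxD adjmx1 hX.
rewrite e adjmxZ !adjmxD !adjmxN adjmx1 !psq //.
by rewrite fmorphV rmorph_nat.
Qed.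

Lemma linE_adj X : E (adjmx X) = adjmx (E X).
Proof.
pose A := X + adjmx X; pose B := 'i *: (X - adjmx X).
have hA : adjmx (E A) = E A.
  by apply: linE_herm; rewrite adjmxD adjmxK addrC.
have hB : adjmx (E B) = E B.
  apply: linE_herm.
  by rewrite adjmxZ adjmxD adjmxN adjmxK conjCi scaleNr -scalerN opprB.
move: hA hB; rewrite linED linEZ linED linEN adjmxZ !adjmxD adjmxN conjCi.
rewrite scaleNr -scalerN => hA /(scalerI (neq0Ci _)); rewrite opprB => hB.
move: (E X) (E (adjmx X)) hA hB => P Q hA hB.
move: (adjmx P) (adjmx Q) hA hB => P' Q' hA hB.
have : 2 *: (P' - Q) = (P' + Q' - (P + Q)) - (Q' - P' - (P - Q)).
  by apply/matrixP => i j; rewrite !mxE; ring.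
rewrite hA hB !subrr => /eqP; rewrite scaler_eq0 pnatr_eq0 /= subr_eq0.
by move/eqP.
Qed.

End LinearPositive.

(** * Complete positivity implies positivity *)

Section Positivity.
Context {R : realType}.
Local Notation C := R[i].

(** The block matrix has size [\sum_(i < 1) n] rather than [n], so the two sides are compared
    through their quadratic forms. *)
Lemma psdmx_mxblock1 n (X : 'M[C]_n) :
  psdmx (\mxblock_(i < 1, j < 1) X) <-> psdmx X.
Proof.
have quad (u : 'I_1 -> 'rV[C]_n) :
    \mxrow_j u j *m \mxblock_(i < 1, j < 1) X *m adjmx (\mxrow_j u j) =
    u 0 *m X *m adjmx (u 0).
  have -> : adjmx (\mxrow_j u j) = \mxcol_i adjmx (u i).
    by rewrite /adjmx tr_mxrow; apply/matrixP => i j; rewrite !mxE.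
  rewrite mul_mxrow_mxblock mul_mxrow_mxcol.
  by rewrite big_ord1 big_ord1.
split=> hX v; first by have := hX (\mxrow_(j < 1) v); rewrite quad.
by rewrite -[v]submxrowK quad.
Qed.

Lemma completely_positive_psdmx n (E : 'M[C]_n -> 'M[C]_n) X :
  completely_positive E -> psdmx X -> psdmx (E X).
Proof.
by move=> cp /psdmx_mxblock1/(cp 1 (fun _ _ => X))/psdmx_mxblock1.
Qed.
End Positivity.

(** * Projections and corners of a star-subalgebra *)

Section Subalgebra.
Context {R : realType}.
Local Notation C := R[i].
Variables (n : nat) (N : 'M[C]_n -> Prop).
Hypothesis algN : star_subalgebra N.

Lemma subalg1 : N 1%:M. Proof. by case: algN. Qed.

Lemma subalgM A B : N A -> N B -> N (A *m B).
Proof. by case: algN => _ _ + _; apply. Qed.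

Lemma subalg_adj A : N A -> N (adjmx A).
Proof. by case: algN => _ _ _; apply. Qed.

Lemma subalgD A B : N A -> N B -> N (A + B).
Proof. by case: algN => _ + _ _ hA hB; rewrite -[A]scale1r; apply. Qed.

Lemma subalg0 : N 0.
Proof.
by case: algN => N1 + _ _; rewrite -(addNr 1%:M) -scaleN1r; apply.
Qed.

Lemma subalgZ a A : N A -> N (a *: A).
Proof.
by case: algN => _ + _ _ hA; rewrite -[_ *: _]addr0; apply => //; exact: subalg0.
Qed.

Lemma subalgB A B : N A -> N B -> N (A - B).
Proof. by move=> hA hB; rewrite -scaleN1r; apply/subalgD/subalgZ. Qed.

Lemma subalg_sum I (r : seq I) (F : I -> 'M[C]_n) :
  (forall i, N (F i)) -> N (\sum_(i <- r) F i).
Proof.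
by move=> hF; elim/big_ind: _ => //; [exact: subalg0|exact: subalgD].
Qed.

(** Since [A] is half of [H - 'i *: K], the Hermitian matrices [H] and [K] cannot both be scalar. *)
Lemma subalg_herm_nonscalar : (exists A, N A /\ forall c, A <> c%:M) ->
  exists H, [/\ N H, adjmx H = H & forall c, H <> c%:M].
Proof.
case=> A [NA hA]; pose H := A + adjmx A; pose K := 'i *: (A - adjmx A).
have NH : N H by apply/subalgD/subalg_adj.
have NK : N K by apply/subalgZ/subalgB/subalg_adj.
have hH : adjmx H = H by rewrite adjmxD adjmxK addrC.
have hK : adjmx K = K.
  by rewrite adjmxZ adjmxD adjmxN adjmxK conjCi scaleNr -scalerN opprB.
have [sH|] := pselect (forall c, H <> c%:M); first by exists H.
have [sK|] := pselect (forall c, K <> c%:M); first by exists K.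
move=> /existsNP[b /contrapT Kb] /existsNP[a /contrapT Ha].
case: (hA (2^-1 * (a - 'i * b))).
have : A = 2^-1 *: (H - 'i *: K).
  rewrite /H /K scalerA -expr2 sqrCi scaleN1r opprK addrACA subrr addr0.
  by rewrite scalerDr -scalerDl -[LHS]scale1r; congr (_ *: _); field.
by rewrite Ha Kb scale_scalar_mx -raddfB /= scale_scalar_mx.
Qed.

Lemma subalg_mxfun_prod H (T : eqType) (r : seq T) (g h : T -> R) : N H -> adjmx H = H ->
  N (mxfun (fun x => \prod_(k <- r) (g k * x + h k)) H).
Proof.
move=> NH hH; elim: r => [|k r IH].
  rewrite (eq_mxfun (g := fun=> 1)) => [|k]; last by rewrite big_nil.
  by rewrite mxfun_cst; exact: subalg1.
rewrite (eq_mxfun (g := fun x => (g k * x + h k) * \prod_(k <- r) (g k * x + h k))).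
  rewrite -mxfunM; apply: subalgM; last exact: IH.
  rewrite -mxfunD -mxfunZ mxfun_id // mxfun_cst.
  apply/subalgD; first exact: subalgZ.
  by rewrite -scalemx1; exact/subalgZ/subalg1.
by move=> j; rewrite big_cons.
Qed.

(* Lagrange interpolation puts every spectral projection of [H] in [N]. *)
Lemma subalg_spectral_proj H i : N H -> adjmx H = H ->
  N (mxfun (fun x => (x == eigval H i)%:R) H).
Proof.
move=> NH hH; pose e := eigval H.
(* The affine factor is [(x - e k) / (e i - e k)], replaced by 1 when the two eigenvalues coincide,
   so multiplicities cause no division by zero. *)
pose g k := if e k == e i then 0 else (e i - e k)^-1.
pose h k := if e k == e i then 1 else - e k / (e i - e k).
have := subalg_mxfun_prod (index_enum 'I_n) g h NH hH.
rewrite (eq_mxfun (g := fun x => (x == eigval H i)%:R)) // => j.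
rewrite -/(e i) -/(e j); case: (eqVneq (e j) (e i)) => [->|ne].
  apply: big1 => k _; rewrite /g /h; case: eqVneq => [_|ne]; first by rewrite mul0r add0r.
  by field; rewrite subr_eq0 eq_sym.
rewrite (bigD1 j) //= /g /h (negPf ne).
suff -> : (e i - e j)^-1 * e j + - e j / (e i - e j) = 0 by rewrite mul0r.
by rewrite mulrC mulNr subrr.
Qed.

Lemma subalg_projection : (exists A, N A /\ forall c, A <> c%:M) ->
  exists p, [/\ N p, p *m p = p, adjmx p = p, p <> 0 & p <> 1%:M].
Proof.
move=> /subalg_herm_nonscalar[H [NH hH sH]].
have [i [j ne]] : exists i j, eigval H j != eigval H i.
  apply: contrapT => hn.
  (* In size zero every matrix is scalar; otherwise, if all eigenvalues agree, [H] is the scalar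
     given by any one of them. *)
  have [n0|[i0]] : n = 0%N \/ exists i : 'I_n, True.
    by case: (n) => [|m]; [left|right; exists ord0].
  - by case: (sH 0); apply/matrixP=> k; have := ltn_ord k; rewrite {2}n0.
  - move=> _; case: (sH ((eigval H i0)%:C)%C); rewrite -(mxfun_cst _ H) -{1}(mxfun_id hH).
    apply: eq_mxfun => k; apply: contrapT => /eqP ne; case: hn.
    by exists i0, k.
exists (mxfun (fun x => (x == eigval H i)%:R) H); split.
- exact: subalg_spectral_proj.
- by rewrite mxfunM; apply: eq_mxfun => k; case: eqP; rewrite ?mulr1 ?mulr0.
- exact: mxfun_adj.
- move=> p0; have := mxfun_diag (fun x => (x == eigval H i)%:R) H.
  rewrite p0 mulmx0 mul0mx => /matrixP/(_ i i); rewrite !mxE !eqxx mulr1n.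
  by move/esym/eqP; rewrite oner_eq0.
- move=> p1; have := mxfun_diag (fun x => (x == eigval H i)%:R) H.
  rewrite p1 mulmx1 spectral_mulV => /matrixP/(_ j j); rewrite !mxE !eqxx mulr1n.
  by rewrite (negPf ne) => /eqP; rewrite oner_eq0.
Qed.

(* If all corners [b M a], [a M b] lie in [N] then so does [a M a]: insert a
   rank-one idempotent supported under [b]. *)
Lemma subalg_corner (a b : 'M[C]_n) : b *m b = b -> adjmx b = b -> b <> 0 ->
  (forall M, N (b *m M *m a)) -> (forall M, N (a *m M *m b)) ->
  forall M, N (a *m M *m a).
Proof.
move=> bb hb b0 hba hab M.
have [k rk] : exists k, row k b != 0.
  apply: contrapT => hn; apply: b0; apply/row_matrixP => k; rewrite row0.
  by apply: contrapT => /eqP rk; apply: hn; exists k.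
pose u := row k b.
have ub : u *m b = u by rewrite -row_mul bb.
pose r := (u *m adjmx u) 0 0.
have r0 : r != 0.
  apply: contra rk; rewrite /r mxE psumr_eq0 => [/allP h|j _]; last first.
    by rewrite !mxE mul_conjC_ge0.
  apply/eqP/rowP => j; have := h j (mem_index_enum j).
  by rewrite !mxE /= mul_conjC_eq0 => /eqP.
have uu : u *m adjmx u = r%:M by rewrite [LHS]mx11_scalar.
rewrite [M]matrix_sum_delta mulmx_sumr mulmx_suml; apply: subalg_sum => i.
rewrite mulmx_sumr mulmx_suml; apply: subalg_sum => j.
rewrite -scalemxAr -scalemxAl; apply: subalgZ.
have -> : delta_mx i j = delta_mx i (0 : 'I_1) *m delta_mx 0 j :> 'M[C]_n.
  by rewrite mul_delta_mx.
(* Since [u *m b = u] and [u *m adjmx u = r] is nonzero, inserting [r^-1] times this scalar splits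
   the matrix unit into a product of two off-diagonal corners. *)
have -> : a *m (delta_mx i (0 : 'I_1) *m delta_mx 0 j) *m a =
   r^-1 *: ((a *m (delta_mx i 0 *m u) *m b) *m (b *m (adjmx u *m delta_mx 0 j) *m a)).
  rewrite -!mulmxA [b *m (b *m _)]mulmxA bb [u *m (b *m _)]mulmxA ub.
  rewrite [u *m (adjmx u *m _)]mulmxA uu mul_scalar_mx -!scalemxAr scalerA.
  by rewrite mulVf // scale1r.
exact/subalgZ/subalgM.
Qed.

(** If one off-diagonal corner lay in [N], so would the other by taking adjoints, then both diagonal
    corners by [subalg_corner], hence every matrix. *)
Lemma subalg_offdiag p : N p -> p *m p = p -> adjmx p = p -> p <> 0 -> p <> 1%:M ->
  (exists X, ~ N X) -> exists Y, ~ N ((1%:M - p) *m Y *m p).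
Proof.
move=> Np pp hp p0 p1 [X NX]; apply/existsNP => hY; apply: NX.
set q := 1%:M - p in hY.
have hq : adjmx q = q by rewrite adjmxD adjmxN adjmx1 hp.
have qq : q *m q = q.
  by rewrite mulmxBr mulmx1 mulmxBl mul1mx pp subrr subr0.
have q0 : q <> 0 by move/eqP; rewrite subr_eq0 => /eqP/esym.
have hY' M : N (p *m M *m q).
  by have := subalg_adj (hY (adjmx M)); rewrite !adjmxM adjmxK hq hp mulmxA.
have -> : X = p *m X *m p + p *m X *m q + (q *m X *m p + q *m X *m q).
  have pq : p + q = 1%:M by rewrite addrC subrK.
  by rewrite -!mulmxDr pq !mulmx1 -mulmxDl pq mul1mx.
apply/subalgD; apply/subalgD => //; first exact: (subalg_corner qq).
exact: (subalg_corner pp).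
Qed.

End Subalgebra.

(** * Matrix families bounded on the unit interval *)

Section Bounded.
Context {R : realType}.
Local Notation C := R[i].

(** Plays the role of O(1) as [t] tends to 0. Powers of [t] stay explicit in the identities, and the
    coefficients left over are built by operations under which this predicate is closed. *)
Definition mxbnd m n (F : R -> 'M[C]_(m, n)) := exists2 K : R, 0 <= K &
  forall t, 0 <= t <= 1 -> forall i j, `|F t i j| <= (K%:C)%C.

Lemma mxbnd_cst m n (A : 'M[C]_(m, n)) : mxbnd (fun=> A).
Proof.
exists (complex.Re (\sum_i \sum_j `|A i j|)).
  have : 0 <= \sum_i \sum_j `|A i j|.
    by do 2![apply: sumr_ge0 => ? _].
  by rewrite lecE => /andP[].
move=> t _ i j; rewrite RRe_real; last first.
  by apply: ger0_real; do 2![apply: sumr_ge0 => ? _].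
rewrite (bigD1 i) //= (bigD1 j) //= -addrA lerDl addr_ge0 //.
  by apply: sumr_ge0.
by do 2![apply: sumr_ge0 => ? _].
Qed.

Lemma mxbndD m n (F G : R -> 'M[C]_(m, n)) :
  mxbnd F -> mxbnd G -> mxbnd (fun t => F t + G t).
Proof.
move=> [K K0 hF] [L L0 hG]; exists (K + L); first exact: addr_ge0.
move=> t ht i j; rewrite mxE rmorphD.
by apply: le_trans (ler_normD _ _) _; apply: lerD; [exact: hF|exact: hG].
Qed.

Lemma mxbndN m n (F : R -> 'M[C]_(m, n)) : mxbnd F -> mxbnd (fun t => - F t).
Proof. by move=> [K K0 hF]; exists K => // t ht i j; rewrite mxE normrN hF. Qed.

Lemma mxbndZ m n (F : R -> 'M[C]_(m, n)) :
  mxbnd F -> mxbnd (fun t => (t%:C)%C *: F t).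
Proof.
move=> [K K0 hF]; exists K => // t ht i j; rewrite mxE normrM.
apply: le_trans (hF t ht i j); rewrite ler_piMl //.
case/andP: ht => t0 t1; rewrite ger0_norm ?ler0c //.
by rewrite -[1]/((1%:C)%C) lecR.
Qed.

Lemma mxbndX m n (F : R -> 'M[C]_(m, n)) k :
  mxbnd F -> mxbnd (fun t => (t%:C)%C ^+ k *: F t).
Proof.
move=> [K K0 hF]; exists K => // t ht i j; rewrite mxE normrM.
apply: le_trans (hF t ht i j); rewrite ler_piMl // normrX.
case/andP: ht => t0 t1; rewrite exprn_ile1 // ger0_norm ?ler0c //.
by rewrite -[1]/((1%:C)%C) lecR.
Qed.

Lemma mxbndM m n k (F : R -> 'M[C]_(m, n)) (G : R -> 'M[C]_(n, k)) :
  mxbnd F -> mxbnd G -> mxbnd (fun t => F t *m G t).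
Proof.
move=> [K K0 hF] [L L0 hG]; exists (\sum_(i < n) K * L).
  by apply: sumr_ge0 => i _; exact: mulr_ge0.
move=> t ht i j; rewrite mxE realC_sum.
apply: le_trans (ler_norm_sum _ _ _) _; apply: ler_sum => l _.
by rewrite normrM realCM ler_pM // ?hF ?hG.
Qed.

Lemma mxbnd_linE n (E : 'M[C]_n -> 'M[C]_n) (F : R -> 'M[C]_n) :
  (forall (a : C) X Y, E (a *: X + Y) = a *: E X + E Y) ->
  mxbnd F -> mxbnd (fun t => E (F t)).
Proof.
move=> Elin [K K0 hF].
have [L L0 hL] : exists2 L : R, 0 <= L &
    forall i j k l, `|E (delta_mx i j) k l| <= (L%:C)%C.
  pose M : 'M[C]_n := \matrix_(k, l) \sum_i \sum_j `|E (delta_mx i j) k l|.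
  have [L L0 hL] := mxbnd_cst M; exists L => // i j k l.
  have := hL 0; rewrite lexx ler01 => /(_ isT k l); apply: le_trans.
  rewrite [M k l]mxE [leRHS]ger0_norm; last by do 2![apply: sumr_ge0 => ? _].
  rewrite (bigD1 i) //= (bigD1 j) //= -addrA lerDl addr_ge0 //.
    by apply: sumr_ge0.
  by do 2![apply: sumr_ge0 => ? _].
exists (\sum_(i < n) \sum_(j < n) K * L).
  by do 2![apply: sumr_ge0 => ? _]; exact: mulr_ge0.
move=> t ht i j; rewrite (linE_delta Elin) summxE realC_sum.
apply: le_trans (ler_norm_sum _ _ _) _; apply: ler_sum => k _.
rewrite summxE realC_sum.
apply: le_trans (ler_norm_sum _ _ _) _; apply: ler_sum => l _.
by rewrite mxE normrM realCM ler_pM // ?hF ?hL.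
Qed.

Lemma mxbnd_sum n (F : R -> 'M[C]_n) : mxbnd F -> exists2 K : R, 0 <= K &
  forall t, 0 <= t <= 1 -> \sum_i \sum_j `|F t i j| <= (K%:C)%C.
Proof.
move=> [K K0 hF]; exists (\sum_(i < n) \sum_(j < n) K).
  by do 2![apply: sumr_ge0 => ? _].
move=> t ht; rewrite realC_sum; apply: ler_sum => i _.
by rewrite realC_sum; apply: ler_sum => j _; exact: hF.
Qed.

Lemma mxbnd_tr n (F : R -> 'M[C]_n) : mxbnd F -> exists2 K : R, 0 <= K &
  forall t, 0 <= t <= 1 -> `|complex.Re (\tr (F t))| <= K.
Proof.
move=> [K K0 hF]; exists (\sum_(i < n) K); first exact: sumr_ge0.
move=> t ht; rewrite -lecR; apply: le_trans (normc_ge_Re _) _.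
rewrite realC_sum; apply: le_trans (ler_norm_sum _ _ _) _.
by apply: ler_sum => i _; exact: hF.
Qed.

End Bounded.

(** * Scalar estimates for the logarithm *)

Section ScalarEstimates.
Context {R : realType}.

(* A majorant of [ln] on the eigenvalues of an approximate projection: being a
   polynomial it has a computable trace, yet it keeps the order [ln t] near 0. *)
Lemma ln_le_quadratic (K t w : R) : 0 < K -> 0 < t <= 1 ->
  1 + ln (2 * K) <= - ln t -> 0 < w -> `|w * w - w| <= K * t ^+ 2 ->
  ln w <= (w - 1) - (- ln t) * ((w - 1) * (w - 1))
          + 4 * K ^+ 2 * (- ln t) * t ^+ 4.
Proof.
move=> K0 /andP[t0 t1] hL w0 hw.
have L0 : 0 <= - ln t by rewrite oppr_ge0 ln_le0.
have lnw : ln w <= w - 1.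
  have := @le_ln1Dx R (w - 1); rewrite [1 + _]addrC subrK; apply.
  by rewrite ltrBrDr addNr.
have Kt : 0 < K * t ^+ 2 by rewrite mulr_gt0 // exprn_gt0.
have e : 4 * K ^+ 2 * (- ln t) * t ^+ 4 = (- ln t) * ((2 * (K * t ^+ 2)) ^+ 2).
  by ring.
rewrite e; move: L0 hL; set L := - ln t => L0 hL.
(* The hypothesis leaves two clusters. Above 1/2 it gives [|w - 1| <= 2 K t^2], and the quartic term
   pays for the subtracted square. *)
case: (leP w (2^-1)) => hw2; last first.
  suff : (w - 1) * (w - 1) <= (2 * (K * t ^+ 2)) ^+ 2.
    by move/(ler_wpM2l L0); lra.
  rewrite -expr2 -[leLHS]real_normK ?num_real // lerXn2r ?nnegrE //.
    by rewrite mulr_ge0 // ltW.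
  have : `|w * w - w| = w * `|w - 1|.
    by rewrite -{3}[w]mulr1 -mulrBr normrM gtr0_norm.
  move=> ew; rewrite ew in hw.
  have := normr_ge0 (w - 1); move: hw; move: `|w - 1| => z hw z0.
  nra.
(* In the lower cluster [ln w <= ln (2 K) - 2 L <= - 1 - L] because [t] is small, while the
   right-hand side is at least [- 1 - L]. *)
have w2 : w <= 2 * K * t ^+ 2.
  have : w - w * w <= K * t ^+ 2 by apply: le_trans hw; rewrite -normrN opprB ler_norm.
  nra.
have : ln w <= ln (2 * K) - 2 * L.
  apply: (@le_trans _ _ (ln (2 * K * t ^+ 2))).
    by rewrite ler_ln // posrE // !mulr_gt0 // exprn_gt0.
  rewrite lnM ?posrE ?exprn_gt0 ?mulr_gt0 // lnXn // /L mulr2n; lra.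
have : (w - 1) * (w - 1) <= 1 by nra.
move/(ler_wpM2l L0).
have : 0 <= L * (2 * (K * t ^+ 2)) ^+ 2 by rewrite mulr_ge0 // sqr_ge0.
lra.
Qed.

Lemma le0_of_linear_bound (a c b : R) (L0 : R) : 0 < c ->
  (forall L, L0 <= L -> a * (c * L) <= b) -> a <= 0.
Proof.
move=> c0 h; rewrite leNgt; apply/negP => a0.
pose L := Num.max L0 ((`|b| + 1) / (a * c)).
have := h L; rewrite le_max lexx => /(_ isT).
have : (`|b| + 1) / (a * c) <= L by rewrite le_max lexx orbT.
rewrite ler_pdivrMr ?mulr_gt0 // mulrC => h1 h2.
have := ler_norm b; lra.
Qed.

End ScalarEstimates.

(** * Exact expansions of the traces along the curve *)

Section Perturbation.
Context {R : realType}.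
Local Notation C := R[i].
Variables (n : nat) (p S Si U B : 'M[C]_n) (E : 'M[C]_n -> 'M[C]_n).

Hypothesis pp : p *m p = p.
Hypothesis hp : adjmx p = p.
Hypothesis Sp : S *m p = p *m S.
Hypothesis Sip : Si *m p = p *m Si.
Hypothesis SSi : S *m Si = 1%:M.
Hypothesis SiS : Si *m S = 1%:M.

Local Notation q := (1%:M - p).
Hypothesis qUp : q *m U *m p = U.

Let pq : p *m q = 0. Proof. by rewrite mulmxBr mulmx1 pp subrr. Qed.
Let qp : q *m p = 0. Proof. by rewrite mulmxBl mul1mx pp subrr. Qed.
Let qq : q *m q = q. Proof. by rewrite mulmxBr mulmx1 qp subr0. Qed.
Let hq : adjmx q = q. Proof. by rewrite adjmxD adjmxN adjmx1 hp. Qed.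
Let Sq : S *m q = q *m S. Proof. by rewrite mulmxBr mulmxBl mulmx1 mul1mx Sp. Qed.

Let pU : p *m U = 0. Proof. by rewrite -qUp !mulmxA pq !mul0mx. Qed.
Let Up : U *m p = U. Proof. by rewrite -qUp -!mulmxA pp. Qed.
Let Uq : U *m q = 0. Proof. by rewrite -qUp -!mulmxA pq !mulmx0. Qed.
Let U'p : adjmx U *m p = 0. Proof. by rewrite -hp -adjmxM pU /adjmx trmx0 map_mx0. Qed.
Let pU' : p *m adjmx U = adjmx U. Proof. by rewrite -{1}hp -adjmxM Up. Qed.
Let U'q : adjmx U *m q = adjmx U. Proof. by rewrite mulmxBr mulmx1 U'p subr0. Qed.

(** [U] exchanges the ranges of [p] and [q], whereas [T] preserves them. *)
Let tr_off T : T *m p = p *m T -> \tr (U *m T) = 0 /\ \tr (adjmx U *m T) = 0.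
Proof.
move=> Tp; split.
  by rewrite -{1}Up -mulmxA -Tp mulmxA mxtrace_mulC mulmxA pU mul0mx mxtrace0.
by rewrite -{1}pU' -mulmxA mxtrace_mulC -mulmxA Tp mulmxA U'p mul0mx mxtrace0.
Qed.

Definition pertZ1 := U + adjmx U.
Local Notation Z1 := pertZ1.
Definition pertZ (t : C) := S *m p + t *: Z1 + t ^+ 2 *: B.
(** The square of [pertZ t] has first-order coefficient [pertW1] and second-order remainder
    [pertV t]; [pertOm t] is the deviation of the conditional expectation from [p], divided by
    [t^2]. *)
Definition pertW1 := S *m p *m Z1 + Z1 *m (S *m p).
Local Notation W1 := pertW1.
Definition pertV (t : C) := Z1 *m Z1 + S *m p *m B + B *m (S *m p) +
  t *: (Z1 *m B + B *m Z1) + t ^+ 2 *: (B *m B).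
Definition pertOm (t : C) := E (Si *m pertV t *m Si).

Let Ap : S *m p *m p = S *m p. Proof. by rewrite -mulmxA pp. Qed.
Let Aq : S *m p *m q = 0. Proof. by rewrite -mulmxA pq mulmx0. Qed.
Let qA : q *m (S *m p) = 0. Proof. by rewrite mulmxA -Sq -mulmxA qp mulmx0. Qed.

Lemma pertZ_sqr t : pertZ t *m pertZ t =
  S *m p *m (S *m p) + t *: W1 + t ^+ 2 *: pertV t.
Proof.
rewrite /pertZ /pertV /W1; move: (S *m p) Z1 B => a b c.
rewrite !mulmxDl !mulmxDr -!scalemxAl -!scalemxAr.
move: (a *m a) (a *m b) (a *m c) (b *m a) (b *m b) (b *m c) (c *m a) (c *m b) (c *m c).
by move=> *; apply/matrixP=> i j; rewrite !mxE; ring.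
Qed.

Lemma tr_W1 : \tr W1 = 0.
Proof.
rewrite mxtraceD mxtrace_mulC -mulr2n mulmxDl mxtraceD.
have := @tr_off (S *m p); rewrite Ap mulmxA -Sp -mulmxA pp.
by case=> // -> ->; rewrite addr0 mul0rn.
Qed.

Lemma tr_W1q : \tr (W1 *m q) = 0.
Proof.
rewrite mulmxDl mxtraceD -[_ *m _ *m q]mulmxA.
rewrite -[Z1 *m (S *m p) *m q]mulmxA Aq mulmx0 mxtrace0 addr0.
by rewrite mxtrace_mulC -mulmxA qA mulmx0 mxtrace0.
Qed.

Lemma tr_Z1S : \tr (Z1 *m S) = 0.
Proof. by rewrite mulmxDl mxtraceD; have [-> ->] := tr_off Sp; rewrite addr0. Qed.

(** The terms of order zero cancel and those of order one are off-diagonal, hence traceless: Klein's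
    bound costs only O(t^2). *)
Lemma pert_klein t :
  \tr (pertZ t *m pertZ t) - \tr (pertZ t *m S) =
  t ^+ 2 * \tr (pertV t - B *m S).
Proof.
have e : \tr (S *m p *m (S *m p)) = \tr (S *m p *m S).
  by rewrite [S *m p in X in _ *m X]Sp mulmxA Ap.
rewrite pertZ_sqr /pertZ; move: (pertV t) => V.
rewrite !mulmxDl -!scalemxAl !mxtraceD !mxtraceZ e tr_W1 tr_Z1S.
by rewrite raddfN /=; ring.
Qed.

Hypothesis Elin : forall (a : C) X Y, E (a *: X + Y) = a *: E X + E Y.
Hypothesis Ep : E p = p.
Hypothesis ESiU : E (Si *m U) = 0.
Hypothesis EU'Si : E (adjmx U *m Si) = 0.

(** Conjugating [W1] by [Si] leaves [adjmx U *m Si + Si *m U], which [E] annihilates; this removes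
    the first-order term. *)
Lemma pert_omega t :
  E (Si *m (pertZ t *m pertZ t) *m Si) = p + t ^+ 2 *: pertOm t.
Proof.
rewrite pertZ_sqr !mulmxDr !mulmxDl -!scalemxAr -!scalemxAl.
rewrite !(linED Elin) !(linEZ Elin) -/(pertOm t).
have -> : Si *m (S *m p *m (S *m p)) *m Si = p.
  rewrite !mulmxA SiS mul1mx -[p *m S]Sp -[_ *m p *m p]mulmxA pp Sp.
  by rewrite -mulmxA SSi mulmx1.
have -> : Si *m W1 *m Si = adjmx U *m Si + Si *m U.
  rewrite mulmxDr mulmxDl; congr (_ + _).
    by rewrite !mulmxA SiS mul1mx mulmxDr pU pU' add0r.
  by rewrite !mulmxA -mulmxA -Sip mulmxA -[_ *m S *m Si]mulmxA SSi mulmx1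
    -mulmxA mulmxDl Up U'p addr0.
by rewrite (linED Elin) ESiU EU'Si addr0 scaler0 addr0 Ep.
Qed.

Lemma pert_omega_idem t (w := p + t ^+ 2 *: pertOm t) :
  w *m w - w = t ^+ 2 *: (p *m pertOm t + pertOm t *m p - pertOm t
     + t ^+ 2 *: (pertOm t *m pertOm t)).
Proof.
rewrite /w; move: (pertOm t) => O.
rewrite mulmxDl !mulmxDr -!scalemxAl -!scalemxAr pp.
move: (p *m O) (O *m p) (O *m O) => *.
by apply/matrixP=> i j; rewrite !mxE; ring.
Qed.

Let w1E t : p + t ^+ 2 *: pertOm t - 1%:M = t ^+ 2 *: pertOm t - q.
Proof. by rewrite opprB addrCA addrA. Qed.

Lemma pert_tr1 t : \tr (pertZ t *m pertZ t *m (p + t ^+ 2 *: pertOm t - 1%:M)) =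
  t ^+ 2 * \tr (pertZ t *m pertZ t *m pertOm t - pertV t *m q).
Proof.
rewrite w1E mulmxBr -scalemxAr [in X in _ - X]pertZ_sqr.
move: (pertV t) (pertOm t) (pertZ t) => V O Z; rewrite !mulmxDl -!scalemxAl.
rewrite -[_ *m (S *m p) *m q]mulmxA Aq mulmx0 add0r !(mxtraceD, raddfN) /=.
by rewrite !(mxtraceD, mxtraceZ) tr_W1q; ring.
Qed.

Definition pertV' (t : C) := (Z1 *m B + B *m Z1) + t *: (B *m B).

(** [S *m p] vanishes against [q] on either side, so at leading order only [U *m adjmx U] survives
    under [q]. Its trace is the mass responsible for the divergence. *)
Lemma tr_Vq t : \tr (pertV t *m q) = \tr (U *m adjmx U) + t * \tr (pertV' t *m q).
Proof.
have -> : pertV t = Z1 *m Z1 + S *m p *m B + B *m (S *m p) + t *: pertV' t.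
  by rewrite /pertV -addrA; congr (_ + _); rewrite [RHS]scalerDr scalerA -expr2.
move: (pertV' t) => V'; rewrite !mulmxDl -scalemxAl !mxtraceD mxtraceZ; congr (_ + _).
rewrite -[B *m _ *m q]mulmxA Aq mulmx0 mxtrace0 addr0.
rewrite [X in _ + X]mxtrace_mulC mulmxA qA mul0mx mxtrace0 addr0.
have Z1q : Z1 *m q = adjmx U by rewrite mulmxDl Uq U'q add0r.
have U'U' : adjmx U *m adjmx U = 0.
  by rewrite -{1}U'q -mulmxA -pU' [q *m (p *m _)]mulmxA qp mul0mx mulmx0.
by rewrite -!mulmxA Z1q U'U' mxtrace0 addr0.
Qed.

Definition pertQ (t : C) :=
  pertV' t *m q - (W1 + t *: pertV t) *m (q *m pertOm t + pertOm t *m q)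
  + t *: (pertZ t *m pertZ t *m (pertOm t *m pertOm t)).

(** The cross terms with [pertOm] meet [q], which kills the zero-order part of the square of
    [pertZ]; this gains the extra factor [t] that makes the remainder cubic and able to absorb
    [- ln t]. *)
Lemma pert_tr2 t (w := p + t ^+ 2 *: pertOm t - 1%:M) :
  \tr (pertZ t *m pertZ t *m (w *m w)) =
  t ^+ 2 * \tr (U *m adjmx U) + t ^+ 3 * \tr (pertQ t).
Proof.
have -> : w *m w = q - t ^+ 2 *: (q *m pertOm t + pertOm t *m q)
                   + t ^+ 4 *: (pertOm t *m pertOm t).
  rewrite /w w1E; move: (pertOm t) (q) qq => O r rr.
  rewrite mulmxBl !mulmxBr -!scalemxAl -!scalemxAr rr.
  move: (r *m O) (O *m r) (O *m O) => *.
  by apply/matrixP=> i j; rewrite !mxE; ring.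
have WqE X : \tr (pertZ t *m pertZ t *m (q *m X + X *m q)) =
    t * \tr ((W1 + t *: pertV t) *m (q *m X + X *m q)).
  have : \tr (S *m p *m (S *m p) *m (q *m X + X *m q)) = 0.
    move: (S *m p) (q) Aq qA => A r Ar rA.
    rewrite mulmxDr mxtraceD !mulmxA -[A *m A *m r]mulmxA Ar mulmx0 mul0mx mxtrace0 add0r.
    by rewrite mxtrace_mulC !mulmxA rA !mul0mx mxtrace0.
  rewrite pertZ_sqr; move: (pertV t) (q *m X + X *m q) => V Y Y0.
  have -> : S *m p *m (S *m p) + t *: W1 + t ^+ 2 *: V =
            S *m p *m (S *m p) + t *: (W1 + t *: V).
    by rewrite [in RHS]scalerDr scalerA -expr2 addrA.
  by move: (W1 + _) => K; rewrite mulmxDl -scalemxAl mxtraceD mxtraceZ Y0 add0r.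
have Wq : \tr (pertZ t *m pertZ t *m q) = t ^+ 2 * \tr (pertV t *m q).
  rewrite pertZ_sqr; move: (pertV t) => V.
  rewrite !mulmxDl -!scalemxAl !mxtraceD !mxtraceZ tr_W1q.
  by rewrite -[_ *m (S *m p) *m q]mulmxA Aq mulmx0 mxtrace0 mulr0 !add0r.
rewrite mulmxDr mulmxBr -!scalemxAr mxtraceD raddfB /= !mxtraceZ WqE Wq tr_Vq.
rewrite /pertQ; move: (pertV' t) (pertV t) (pertOm t) (pertZ t) => V' V O Z.
rewrite mxtraceD raddfB /= mxtraceZ; ring.
Qed.

End Perturbation.

(** * The invariant state and a lower bound for the entropy *)

Section InvariantWeight.
Context {R : realType}.
Local Notation C := R[i].
Variable n : nat.
Implicit Types (N : 'M[C]_n -> Prop) (E : 'M[C]_n -> 'M[C]_n).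

Lemma mxtrace_gram_gt0 (M : 'M[C]_n) : M != 0 -> 0 < \tr (M *m adjmx M).
Proof.
move=> M0; rewrite lt_def; apply/andP; split; last first.
  apply: psdmx_tr_ge0; rewrite -[M in M *m _]mulmx1; apply: psdmx_conj.
  exact: (@psdmx_scalar R n 1 ler01).
have ge0 i j : 0 <= M i j * Num.conj (M i j) by rewrite mul_conjC_ge0.
have -> : \tr (M *m adjmx M) = \sum_i \sum_j M i j * Num.conj (M i j).
  by apply: eq_bigr => i _; rewrite mxE; apply: eq_bigr => j _; rewrite !mxE.
apply: contra M0; rewrite psumr_eq0 => [/allP h|i _]; last exact: sumr_ge0.
apply/eqP/matrixP => i j; have := h i (mem_index_enum i); rewrite /= psumr_eq0 //.
by move=> /allP/(_ j (mem_index_enum j)); rewrite /= mul_conjC_eq0 mxE => /eqP.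
Qed.

Lemma psdmx_predual E (a : C) : 0 <= a ->
  (forall (a : C) X Y, E (a *: X + Y) = a *: E X + E Y) ->
  (forall X, psdmx X -> psdmx (E X)) -> psdmx (predual E (a *: 1%:M)).
Proof.
move=> a0 Elin Epos v.
have -> : (v *m predual E (a *: 1%:M) *m adjmx v) 0 0 = a * \tr (E (adjmx v *m v)).
  have <- : \tr (v *m predual E (a *: 1%:M) *m adjmx v) =
            (v *m predual E (a *: 1%:M) *m adjmx v) 0 0 by rewrite /mxtrace big_ord1.
  by rewrite -mulmxA mxtrace_mulC -mulmxA (predualE Elin) scalemx1 mul_scalar_mx mxtraceZ.
apply: mulr_ge0 => //; apply/psdmx_tr_ge0/Epos.
rewrite -[adjmx v]mulmx1 -{2}[v]adjmxK; apply: psdmx_conj.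
exact: (@psdmx_scalar R 1 1 ler01).
Qed.

(** By the bimodule property and cyclicity, [s A X] and [A s X] have the same trace for every [X];
    taking [X] to be the adjoint of the commutator forces the latter to vanish. *)
Lemma predual_comm N E a A : star_subalgebra N -> cond_expectation N E -> N A ->
  predual E (a *: 1%:M) *m A = A *m predual E (a *: 1%:M).
Proof.
move=> algN [Elin _ _ _ Emod] NA; set s := predual _ _.
have trs X : \tr (s *m X) = a * \tr (E X).
  by rewrite (predualE Elin) scalemx1 mul_scalar_mx mxtraceZ.
have N1 := subalg1 algN.
have EAX X : E (A *m X) = A *m E X.
  by have := Emod A 1%:M X NA N1; rewrite !mulmx1.
have EXA X : E (X *m A) = E X *m A.
  by have := Emod 1%:M A X N1 NA; rewrite !mul1mx.
apply/eqP; rewrite -subr_eq0; apply: contraT => /mxtrace_gram_gt0.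
move: (adjmx _) => X; rewrite mulmxBl raddfB /= -mulmxA trs EAX.
rewrite -[A *m s *m X]mulmxA [X in _ - X]mxtrace_mulC -mulmxA trs EXA.
by rewrite mxtrace_mulC subrr ltxx.
Qed.

(** Klein's inequality treats the logarithms of [Z] and [s] jointly, and [g] majorizes that of [w];
    with [g] a polynomial, the bound contains no logarithm of a matrix. *)
Lemma ent2_lower (s X Z w : 'M[C]_n) E (g : R -> R) :
  Gammamx s (1 / 2) X = Z ->
  E (mxpowR (- (1 / 2)) s *m (Z *m Z) *m mxpowR (- (1 / 2)) s) = w ->
  psdmx s -> s \in unitmx -> psdmx Z ->
  (forall k, ln (eigval w k) <= g (eigval w k)) ->
  complex.Re (\tr (Z *m Z)) - complex.Re (\tr (Z *m mxpowR (1 / 2) s))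
  - 2^-1 * complex.Re (\tr (Z *m Z *m mxfun g w)) <= complex.Re (ent2 s E X).
Proof.
move=> XZ Zw hs us hZ hg.
have half : (1 / 2 : C) = ((2^-1)%:C)%C by rewrite mul1r fmorphV rmorph_nat.
have -> : ent2 s E X = \tr (Z *m Z *m mxln Z)
    - ((2^-1)%:C)%C * \tr (Z *m Z *m mxln w) - ((2^-1)%:C)%C * \tr (Z *m Z *m mxln s).
  rewrite /ent2 XZ Zw half; move: (Z *m Z) (mxln Z) (mxln w) (mxln s) => A P Q T.
  by rewrite mulmxBr mulmxBr !raddfB /= -!scalemxAr !mxtraceZ.
have key (a b c d e f : C) :
    complex.Re a - complex.Re b <= complex.Re c - 2^-1 * complex.Re e ->
    complex.Re d <= complex.Re f ->
    complex.Re a - complex.Re b - 2^-1 * complex.Re f <=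
    complex.Re (c - ((2^-1)%:C)%C * d - ((2^-1)%:C)%C * e).
  by rewrite !(ReD, ReN) !ReZ; lra.
exact: (key _ _ _ _ _ _ (klein hZ hs us) (tr_sqr_mxfun_le hZ hg)).
Qed.

Lemma mxfun_quadratic (w : 'M[C]_n) (a b : R) : adjmx w = w ->
  mxfun (fun x => (x - 1) - a * ((x - 1) * (x - 1)) + b) w =
  (w - 1%:M) - (a%:C)%C *: ((w - 1%:M) *m (w - 1%:M)) + (b%:C)%C%:M.
Proof.
move=> hw; have w1 : w - 1%:M = mxfun (fun x => x - 1) w.
  rewrite -mxfunD mxfun_cst mxfun_id // rmorphN raddfN /= //.
rewrite w1 mxfunM -scaleNr.
have -> : - (a%:C)%C = ((- a)%:C)%C :> C by rewrite rmorphN.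
rewrite mxfunZ mxfunD -(mxfun_cst b w) mxfunD.
by apply: eq_mxfun => k; rewrite mulNr.
Qed.

End InvariantWeight.

(** * The Dirichlet form along the curve *)

Section Dirichlet.
Context {R : realType}.
Local Notation C := R[i].
Variables (n : nat) (S p X1 X2 : 'M[C]_n) (E : 'M[C]_n -> 'M[C]_n).
Hypothesis Elin : forall (a : C) X Y, E (a *: X + Y) = a *: E X + E Y.
Hypothesis pp : p *m p = p.
Hypothesis Sp : S *m p = p *m S.
Hypothesis Ep : E p = p.
Hypothesis Epp : forall X, E (p *m X *m p) = p *m E X *m p.
Hypothesis pX1p : p *m X1 *m p = 0.

Definition pertD (t : C) : 'M[C]_n :=
  - (S *m p *m S *m (E X2 - X2) +
     S *m (X1 + t *: X2) *m S *m (E X1 - X1 + t *: (E X2 - X2))).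

(** [E X - X] starts at order [t]. Its first-order pairing with [p] sees only the [p]-corner of
    [E X1 - X1], which is zero because [E] commutes with compression by [p] and [X1] has no such
    corner. *)
Lemma pert_dirichlet (t : C) (X := p + t *: X1 + t ^+ 2 *: X2) :
  - \tr (S *m X *m S *m (E X - X)) = t ^+ 2 * \tr (pertD t).
Proof.
have e0 : \tr (S *m p *m S *m (E X1 - X1)) = 0.
  have -> : S *m p *m S = p *m (S *m S) *m p.
    by rewrite -[in RHS]mulmxA -[in RHS](mulmxA S) Sp !mulmxA -Sp -[_ *m p *m p]mulmxA pp.
  move: (S *m S) => K; rewrite -!mulmxA mxtrace_mulC -mulmxA.
  have -> : p *m (E X1 - X1) *m p = 0.
    by rewrite mulmxBr mulmxBl -Epp pX1p (linE0 Elin) subrr.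
  by rewrite mulmx0 mxtrace0.
have eF : E X - X = t *: (E X1 - X1 + t *: (E X2 - X2)).
  rewrite /X !(linED Elin) !(linEZ Elin) Ep; move: (E X1) (E X2) => *.
  by apply/matrixP=> i j; rewrite !mxE; ring.
have eX : X = p + t *: (X1 + t *: X2) by rewrite /X scalerDr scalerA -expr2 addrA.
have e1 : \tr (S *m p *m S *m (E X1 - X1 + t *: (E X2 - X2))) =
    t * \tr (S *m p *m S *m (E X2 - X2)).
  by rewrite mulmxDr mxtraceD e0 add0r -scalemxAr mxtraceZ.
have eS Y : S *m (p + t *: Y) *m S = S *m p *m S + t *: (S *m Y *m S).
  by rewrite mulmxDr mulmxDl -scalemxAr -scalemxAl.
rewrite eF eX eS /pertD.
move: e1; move: (E X1 - X1 + t *: (E X2 - X2)) (E X2 - X2) (S *m p *m S) => F F2 P e1.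
move: (S *m (X1 + t *: X2) *m S) => G.
rewrite mulmxDl -!scalemxAr -scalemxAl !raddfN /= !mxtraceD !mxtraceZ e1; ring.
Qed.

End Dirichlet.

(** * Uniform bounds, positivity of the curve, and bookkeeping of constants *)

Section PerturbationBounds.
Context {R : realType}.
Local Notation C := R[i].
Variables (n : nat) (p S Si U B : 'M[C]_n) (E : 'M[C]_n -> 'M[C]_n).
Hypothesis Elin : forall (a : C) X Y, E (a *: X + Y) = a *: E X + E Y.

Local Ltac bnd := repeat first
  [ refine (mxbnd_cst _) | refine (mxbndD _ _) | refine (mxbndN _)
  | refine (mxbndZ _) | refine (mxbndX _ _) | refine (mxbndM _ _) | assumption ].

Lemma bnd_pertZ : mxbnd (fun t : R => pertZ p S U B (t%:C)%C).
Proof. by rewrite /pertZ; bnd. Qed.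

Lemma bnd_pertV : mxbnd (fun t : R => pertV p S U B (t%:C)%C).
Proof. by rewrite /pertV; bnd. Qed.

Lemma bnd_pertOm : mxbnd (fun t : R => pertOm p S Si U B E (t%:C)%C).
Proof. by apply: mxbnd_linE => //; have h := bnd_pertV; bnd. Qed.

Lemma bnd_pertQ : mxbnd (fun t : R => pertQ p S Si U B E (t%:C)%C).
Proof.
have := bnd_pertV; have := bnd_pertZ; have := bnd_pertOm.
rewrite /pertQ /pertV' => *; bnd.
Qed.
Variables X1 X2 : 'M[C]_n.

Lemma bnd_pertD : mxbnd (fun t : R => pertD S p X1 X2 E (t%:C)%C).
Proof. by rewrite /pertD; bnd. Qed.
End PerturbationBounds.

Lemma eigval_idem_bound (R : realType) n (w M : 'M[R[i]]_n) (a K : R) k :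
  adjmx w = w -> 0 <= a -> w *m w - w = (a%:C)%C *: M ->
  \sum_i \sum_j `|M i j| <= (K%:C)%C ->
  `|eigval w k * eigval w k - eigval w k| <= K * a.
Proof.
move=> hw a0 wM hM.
have wf : w *m w - w = mxfun (fun x => x * x - 1 * x) w.
  rewrite mul_mxfun_sqr // -{2}(mxfun_id hw) -scaleN1r.
  have -> : (-1 : R[i]) = ((-1)%:C)%C by rewrite rmorphN.
  by rewrite mxfunZ mxfunD; apply: eq_mxfun => j; rewrite mulNr.
have := mxfun_diag (fun x => x * x - 1 * x) w; rewrite -wf wM -scalemxAr -scalemxAl.
have := spectral_diag_bound w M k; move: (spectralmx w *m M *m _) => D hD.
move=> /matrixP/(_ k k); rewrite !mxE eqxx mulr1n => e.
rewrite -lecR; apply: (@le_trans _ _ `|(a%:C)%C * D k k|).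
  by rewrite e; apply: le_trans (normc_ge_Re _); rewrite /= mul1r.
rewrite normrM ger0_norm ?ler0c // mulrC realCM ler_wpM2r ?ler0c //.
exact: le_trans hD hM.
Qed.

(** [B] is chosen to complete the square [(S p + t U) Si (S p + t U)^*]; its identity summand
    supplies the gap [t^2]. *)
Lemma pertZ_gap (R : realType) n (p S Si U : 'M[R[i]]_n) (t : R)
    (B := U *m Si *m adjmx U + 1%:M) :
  p *m p = p -> adjmx p = p -> adjmx S = S -> S *m p = p *m S ->
  Si *m p = p *m Si -> S *m Si = 1%:M -> Si *m S = 1%:M -> U *m p = U ->
  psdmx Si -> psdmx (pertZ p S U B (t%:C)%C - ((t ^+ 2)%:C)%C%:M).
Proof.
move=> pp hp hS Sp Sip SSi SiS Up hSi.
suff -> : pertZ p S U B (t%:C)%C - ((t ^+ 2)%:C)%C%:M =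
    (S *m p + (t%:C)%C *: U) *m Si *m adjmx (S *m p + (t%:C)%C *: U).
  exact: psdmx_conj.
have -> : ((t ^+ 2)%:C)%C = (t%:C)%C ^+ 2 :> R[i] by rewrite rmorphXn.
have pU' : p *m adjmx U = adjmx U by rewrite -{1}hp -adjmxM Up.
have SpSi : S *m p *m Si = p by rewrite -mulmxA -Sip mulmxA SSi mul1mx.
have USip : U *m Si *m p = U *m Si by rewrite -mulmxA Sip mulmxA Up.
rewrite adjmxD adjmxM adjmxZ conj_realC hp hS mulmxDl mulmxDr mulmxDl.
rewrite -!scalemxAl -!scalemxAr mulmxDl -!scalemxAl SpSi.
rewrite [p *m (p *m S)]mulmxA pp pU' [U *m Si *m (p *m S)]mulmxA USip.
rewrite -mulmxA SiS mulmx1 -Sp.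
rewrite /pertZ /pertZ1 /B -[(_ ^+ 2)%:M]scalemx1.
move: (S *m p) (adjmx U) (U *m Si *m _) (1%:M : 'M[R[i]]_n) => *.
by apply/matrixP=> i j; rewrite !mxE; ring.
Qed.

(** After division by [t^2], only the term in [c] keeps a bare factor [L]; the other occurrences of
    [L] come with a factor [t] and are absorbed by [L * t <= 1]. *)
Lemma lsi_arithmetic (R : realType) (alpha L t c K C1 C2 C3 C4 C5 : R)
    (f1 f2 f3 f4 f5 ent : R) :
  0 <= alpha -> 0 <= L -> 0 < t <= 1 -> L * t <= 1 -> 0 <= C3 -> 0 <= C4 ->
  - f1 <= C1 -> f2 <= C2 -> - f3 <= C3 -> f4 <= C4 -> f5 <= C5 ->
  t ^+ 2 * f1 - 2^-1 * (t ^+ 2 * f2 - L * (t ^+ 2 * c + t ^+ 3 * f3)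
    + 4 * K ^+ 2 * L * t ^+ 4 * f4) <= ent ->
  alpha * ent <= t ^+ 2 * f5 ->
  alpha * (2^-1 * c * L) <= C5 + alpha * (C1 + 2^-1 * C2 + 2^-1 * C3 + 2 * K ^+ 2 * C4).
Proof.
move=> a0 L0 /andP[t0 t1] Lt1 C30 C40 h1 h2 h3 h4 h5 hent hlsi.
have Lt0 : 0 <= L * t by rewrite mulr_ge0 // ltW.
have t20 : 0 < t ^+ 2 by rewrite exprn_gt0.
pose m := f1 - 2^-1 * f2 + 2^-1 * (c * L) + 2^-1 * (L * t * f3)
          - 2 * K ^+ 2 * (L * t * t * f4).
have hm : t ^+ 2 * m <= ent.
  by apply: le_trans hent; rewrite le_eqVlt; apply/orP; left; apply/eqP; rewrite /m; field.
have am : alpha * m <= C5.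
  rewrite -(ler_pM2l t20); apply: (@le_trans _ _ (t ^+ 2 * f5)); last by rewrite ler_pM2l.
  by apply: le_trans hlsi; rewrite mulrCA; exact: ler_wpM2l.
have e3 : - C3 <= L * t * f3.
  by rewrite lerNl -mulrN; apply: le_trans (ler_wpM2l Lt0 h3) _; rewrite ler_piMl.
have e4 : L * t * t * f4 <= C4.
  have Ltt0 : 0 <= L * t * t by rewrite mulr_ge0 // ltW.
  apply: le_trans (ler_wpM2l Ltt0 h4) _; rewrite ler_piMl // mulr_ile1 // ltW //.
have e4' : K ^+ 2 * (L * t * t * f4) <= K ^+ 2 * C4 by rewrite ler_wpM2l ?sqr_ge0.
have : 2^-1 * c * L - (C1 + 2^-1 * C2 + 2^-1 * C3 + 2 * K ^+ 2 * C4) <= m.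
  by rewrite /m -!mulrA in e4' *; lra.
move/(ler_wpM2l a0); rewrite mulrBr; lra.
Qed.

(** * The test curve and the vanishing of the constant *)

Section NoLogSobolev.
Context {R : realType}.
Local Notation C := R[i].
Variables (n : nat) (s p Y : 'M[C]_n) (E : 'M[C]_n -> 'M[C]_n).

Hypothesis Elin : forall (a : C) X Y, E (a *: X + Y) = a *: E X + E Y.
Hypothesis E1 : E 1%:M = 1%:M.
Hypothesis Epos : forall X, psdmx X -> psdmx (E X).
Hypothesis Ep : E p = p.
Hypothesis Epp : forall X, E (p *m X *m p) = p *m E X *m p.
Hypothesis EY : E Y = 0.
Hypothesis Y0 : Y != 0.
Hypothesis hs : psdmx s.
Hypothesis us : s \in unitmx.
Hypothesis pp : p *m p = p.
Hypothesis hp : adjmx p = p.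
Hypothesis sp : s *m p = p *m s.
Hypothesis qYp : (1%:M - p) *m Y *m p = Y.

Let S := mxpowR (1 / 2) s.
Let Si := mxpowR (- (1 / 2)) s.
(** The inverse of the factor [mxpowR (1 / 2 / 2) s] in [Gammamx s (1 / 2)]: conjugation by it
    recovers [X] from the prescribed [Z]. *)
Let Si4 := mxpowR (- (1 / 2 / 2)) s.
Let U := S *m Y.
Let B := U *m Si *m adjmx U + 1%:M.
Let Z (t : R) := pertZ p S U B (t%:C)%C.
Let W (t : R) := Z t *m Z t.
Let X (t : R) := Si4 *m Z t *m Si4.
Let w (t : R) := E (Si *m W t *m Si).

Let comm r : mxpowR r s *m p = p *m mxpowR r s.
Proof. by apply: mxfun_comm => //; exact: psdmx_herm. Qed.

Let adj r : adjmx (mxpowR r s) = mxpowR r s. Proof. exact: mxfun_adj. Qed.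

Let inv r : mxpowR r s *m mxpowR (- r) s = 1%:M.
Proof. by rewrite mxpowRD // subrr mxpowR0. Qed.

Let invV r : mxpowR (- r) s *m mxpowR r s = 1%:M.
Proof. by rewrite mxpowRD // addNr mxpowR0. Qed.

Let qUp : (1%:M - p) *m U *m p = U.
Proof.
rewrite /U mulmxA mulmxBl mul1mx -comm -/S -[S in S - _]mulmx1 -mulmxBr.
by rewrite -!mulmxA [(1%:M - p) *m (Y *m p)]mulmxA qYp.
Qed.

Let Up : U *m p = U. Proof. by rewrite -qUp -!mulmxA pp. Qed.

Let ESiU : E (Si *m U) = 0.
Proof. by rewrite /U mulmxA invV mul1mx. Qed.

Let EU'Si : E (adjmx U *m Si) = 0.
Proof.
rewrite /U adjmxM adj -mulmxA inv mulmx1 (linE_adj Elin Epos E1) EY.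
by apply/matrixP=> i j; rewrite !mxE conjC0.
Qed.

Let Si_psd : psdmx Si.
Proof. by apply: psdmx_mxfun => k; exact: powR_ge0. Qed.

Let Zgap t : psdmx (Z t - ((t ^+ 2)%:C)%C%:M).
Proof. by apply: pertZ_gap => //; rewrite /S /Si ?comm ?inv ?invV ?adj. Qed.

Let Zpsd t : psdmx (Z t).
Proof.
rewrite -(subrK ((t ^+ 2)%:C)%C%:M (Z t)); apply: psdmxD => //.
exact/psdmx_scalar/sqr_ge0.
Qed.

Lemma testX_psd t : psdmx (X t).
Proof. by rewrite /X -{2}[Si4]adj; exact: psdmx_conj. Qed.

Let Gamma_X t : Gammamx s (1 / 2) (X t) = Z t.
Proof.
have key (a b z : 'M[C]_n) :
    a *m b = 1%:M -> b *m a = 1%:M -> a *m (b *m z *m b) *m a = z.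
  by move=> ab ba; rewrite -!mulmxA ba mulmx1 mulmxA ab mul1mx.
exact: key (inv _) (invV _).
Qed.

Let wE t : w t = p + (t%:C)%C ^+ 2 *: pertOm p S Si U B E (t%:C)%C.
Proof. by apply: pert_omega => //; [exact: comm|exact: comm|exact: inv|exact: invV]. Qed.

Let SiWSi t : Si *m W t *m Si = (Si *m Z t) *m 1%:M *m adjmx (Si *m Z t).
Proof.
have key (a b : 'M[C]_n) : adjmx a = a -> adjmx b = b ->
    a *m (b *m b) *m a = (a *m b) *m 1%:M *m adjmx (a *m b).
  by move=> ha hb; rewrite adjmxM ha hb mulmx1 !mulmxA.
exact: key (adj _) (psdmx_herm (Zpsd t)).
Qed.

Let w_psd t : psdmx (w t).
Proof.
apply: Epos; rewrite SiWSi; apply: psdmx_conj.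
exact: (@psdmx_scalar R n 1 ler01).
Qed.

(** For [t > 0] the argument of [E] is invertible, hence at least some [c > 0]; a unital positive
    map preserves this lower bound. *)
Let w_gt0 t k : 0 < t -> 0 < eigval (w t) k.
Proof.
move=> t0; have uZ : Z t \in unitmx.
  by apply: gap_unitmx (Zgap t); rewrite exprn_gt0.
have uSi : Si \in unitmx by have /mulmx1_unit[] := inv (1 / 2).
have [c c0 hc] : exists2 c : R, 0 < c & psdmx (Si *m W t *m Si - (c%:C)%C%:M).
  have key (a b : 'M[C]_n) : a \in unitmx -> b \in unitmx ->
    a *m (b *m b) *m a \in unitmx by move=> ua ub; rewrite !unitmx_mul ua ub.
  apply: unit_psdmx_gap (key _ _ uSi uZ).
  by rewrite SiWSi; apply: psdmx_conj; exact: (@psdmx_scalar R n 1 ler01).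
apply: lt_le_trans c0 _; apply: eigval_ge.
have := Epos hc; rewrite (linED Elin) (linEN Elin) -scalemx1 (linEZ Elin) E1.
by rewrite scalemx1.
Qed.

Let w_idem t : w t *m w t - w t = ((t ^+ 2)%:C)%C *:
  (p *m pertOm p S Si U B E (t%:C)%C + pertOm p S Si U B E (t%:C)%C *m p
   - pertOm p S Si U B E (t%:C)%C + (t%:C)%C ^+ 2 *:
   (pertOm p S Si U B E (t%:C)%C *m pertOm p S Si U B E (t%:C)%C)).
Proof. by rewrite wE rmorphXn; exact: pert_omega_idem. Qed.

Let w_idem_bound : exists2 K : R, 0 < K & forall t k, 0 <= t <= 1 ->
  `|eigval (w t) k * eigval (w t) k - eigval (w t) k| <= K * t ^+ 2.
Proof.
have bO := @bnd_pertOm R n p S Si U B E Elin.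
have [K K0 hK] : exists2 K : R, 0 <= K & forall t, 0 <= t <= 1 ->
  \sum_i \sum_j `|(p *m pertOm p S Si U B E (t%:C)%C + pertOm p S Si U B E (t%:C)%C *m p
   - pertOm p S Si U B E (t%:C)%C + (t%:C)%C ^+ 2 *:
   (pertOm p S Si U B E (t%:C)%C *m pertOm p S Si U B E (t%:C)%C)) i j| <= (K%:C)%C.
  apply: mxbnd_sum; apply: mxbndD; last exact/mxbndX/mxbndM.
  apply: mxbndD (mxbndN bO); apply: mxbndD; apply: mxbndM => //; exact: mxbnd_cst.
(* Adding 1 makes the constant strictly positive, as [ln_le_quadratic] requires. *)
exists (K + 1); first by rewrite ltr_wpDl.
move=> t k ht.
have := eigval_idem_bound k (psdmx_herm (w_psd t)) (sqr_ge0 t) (w_idem t) (hK t ht).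
by move/le_trans; apply; rewrite ler_wpM2r ?sqr_ge0 // lerDl.
Qed.

Let XE t : X t = p + (t%:C)%C *: (Si4 *m pertZ1 U *m Si4)
   + (t%:C)%C ^+ 2 *: (Si4 *m B *m Si4).
Proof.
have lin (a b c d : 'M[C]_n) x y : a *m (b + x *: c + y *: d) *m a =
    a *m b *m a + x *: (a *m c *m a) + y *: (a *m d *m a).
  by rewrite !mulmxDr !mulmxDl -!scalemxAr -!scalemxAl.
rewrite /X /Z /pertZ lin; congr (_ + _ + _).
have key (a b : 'M[C]_n) :
    b *m p = p *m b -> b *m a *m b = 1%:M -> b *m (a *m p) *m b = p.
  by move=> bp bab; rewrite -!mulmxA -bp !mulmxA bab mul1mx.
apply: key; first exact: comm.
rewrite (mxpowRD _ _ hs us) (mxpowRD _ _ hs us) -(mxpowR0 s).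
by congr (mxpowR _ s); lra.
Qed.

Let dirichletE t : dirichlet2 s (lindbladian E) (X t) =
  ((t ^+ 2)%:C)%C * \tr (pertD S p (Si4 *m pertZ1 U *m Si4) (Si4 *m B *m Si4) E (t%:C)%C).
Proof.
rewrite /dirichlet2 /sigma_inner /lindbladian (psdmx_herm (testX_psd t)) -/S rmorphXn.
rewrite XE; apply: pert_dirichlet => //; first exact: comm.
have pU : p *m U = 0 by rewrite -qUp !mulmxA mulmxBr mulmx1 pp subrr !mul0mx.
have U'p : adjmx U *m p = 0.
  by rewrite -hp -adjmxM pU /adjmx trmx0 map_mx0.
have key (a u v : 'M[C]_n) : a *m p = p *m a -> p *m u = 0 -> v *m p = 0 ->
    p *m (a *m (u + v) *m a) *m p = 0.
  move=> ap pu vp; have -> : p *m (a *m (u + v) *m a) *m p =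
      a *m (p *m (u + v) *m p) *m a.
    move: (u + v) => M.
    by rewrite !mulmxA -ap -[_ *m a *m p]mulmxA ap !mulmxA.
  by rewrite mulmxDr pu add0r -[p *m v *m p]mulmxA vp !mulmx0 mul0mx.
exact: key (comm _) pU U'p.
Qed.

Let U_neq0 : U != 0.
Proof.
have key (a b y : 'M[C]_n) : b *m a = 1%:M -> y != 0 -> a *m y != 0.
  by move=> ba; apply: contraNneq => ay; rewrite -[y]mul1mx -ba -mulmxA ay mulmx0.
exact: key (invV _) Y0.
Qed.

(** [K] and [b] are the coefficients of the quadratic majorant of [ln]; they are later taken to be
    [- ln t] and the quartic error. *)
Let ent_estimate t K b : (forall k, ln (eigval (w t) k) <=
    (eigval (w t) k - 1) - K * ((eigval (w t) k - 1) * (eigval (w t) k - 1)) + b) ->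
  t ^+ 2 * complex.Re (\tr (pertV p S U B (t%:C)%C - B *m S))
  - 2^-1 * (t ^+ 2 * complex.Re (\tr (W t *m pertOm p S Si U B E (t%:C)%C
                                   - pertV p S U B (t%:C)%C *m (1%:M - p)))
     - K * (t ^+ 2 * complex.Re (\tr (U *m adjmx U))
            + t ^+ 3 * complex.Re (\tr (pertQ p S Si U B E (t%:C)%C)))
     + b * complex.Re (\tr (W t))) <= complex.Re (ent2 s E (X t)).
Proof.
move=> hg; have := @ent2_lower R n s (X t) (Z t) (w t) E
  (fun x => (x - 1) - K * ((x - 1) * (x - 1)) + b) (Gamma_X t) erefl hs us (Zpsd t) hg.
rewrite (mxfun_quadratic _ _ (psdmx_herm (w_psd t))).
have e1 : \tr (Z t *m Z t) - \tr (Z t *m S) =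
    (t%:C)%C ^+ 2 * \tr (pertV p S U B (t%:C)%C - B *m S).
  by apply: pert_klein => //; exact: comm.
have e2 : \tr (Z t *m Z t *m (w t - 1%:M)) =
    (t%:C)%C ^+ 2 * \tr (Z t *m Z t *m pertOm p S Si U B E (t%:C)%C
                         - pertV p S U B (t%:C)%C *m (1%:M - p)).
  by rewrite wE; apply: pert_tr1 => //; exact: comm.
have e3 : \tr (Z t *m Z t *m ((w t - 1%:M) *m (w t - 1%:M))) =
    (t%:C)%C ^+ 2 * \tr (U *m adjmx U)
    + (t%:C)%C ^+ 3 * \tr (pertQ p S Si U B E (t%:C)%C).
  by rewrite wE; apply: pert_tr2 => //; exact: comm.
have -> : \tr (Z t *m Z t *m (w t - 1%:M - (K%:C)%C *: ((w t - 1%:M) *m (w t - 1%:M))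
     + (b%:C)%C%:M)) = \tr (Z t *m Z t *m (w t - 1%:M))
     - (K%:C)%C * \tr (Z t *m Z t *m ((w t - 1%:M) *m (w t - 1%:M)))
     + (b%:C)%C * \tr (Z t *m Z t).
  move: (Z t *m Z t) (w t - 1%:M) => a v.
  rewrite mulmxDr mulmxBr -scalemxAr mul_mx_scalar mxtraceD raddfB /=.
  by rewrite !mxtraceZ.
rewrite e2 e3.
have key (x y z u v r f : C) (k c : R) : x - y = z ->
    complex.Re x - complex.Re y
      - 2^-1 * complex.Re (u - (k%:C)%C * v + (c%:C)%C * r) <= complex.Re f ->
    complex.Re z - 2^-1 * (complex.Re u - k * complex.Re v + c * complex.Re r)
      <= complex.Re f.
  by move=> <-; rewrite !(ReD, ReN) !ReZ.
by move/(key _ _ _ _ _ _ _ _ _ e1); rewrite ReD !ReXM.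
Qed.

Lemma no_lsi (alpha : R) : 0 <= alpha ->
  (forall X, psdmx X -> (alpha%:C)%C * ent2 s E X <= dirichlet2 s (lindbladian E) X) ->
  alpha <= 0.
Proof.
move=> a0 lsi.
have bV := @bnd_pertV R n p S U B; have bZ := @bnd_pertZ R n p S U B.
have bO := @bnd_pertOm R n p S Si U B E Elin.
have [C1 C10 h1] := mxbnd_tr (mxbndD bV (mxbndN (mxbnd_cst (B *m S)))).
have [C2 C20 h2] := mxbnd_tr (mxbndD (mxbndM (mxbndM bZ bZ) bO)
  (mxbndN (mxbndM bV (mxbnd_cst (1%:M - p))))).
have [C3 C30 h3] := mxbnd_tr (@bnd_pertQ R n p S Si U B E Elin).
have [C4 C40 h4] := mxbnd_tr (mxbndM bZ bZ).
have [C5 C50 h5] := mxbnd_tr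
  (@bnd_pertD R n p S E (Si4 *m pertZ1 U *m Si4) (Si4 *m B *m Si4)).
have [K K0 hK] := w_idem_bound.
have c0 : 0 < complex.Re (\tr (U *m adjmx U)).
  by have := mxtrace_gram_gt0 U_neq0; rewrite ltcE => /andP[].
set c := complex.Re _ in c0.
(* The threshold on [L] ensures [t <= 1] and the smallness condition of [ln_le_quadratic]. *)
apply: (@le0_of_linear_bound R _ (2^-1 * c)
  (C5 + alpha * (C1 + 2^-1 * C2 + 2^-1 * C3 + 2 * K ^+ 2 * C4))
  (Num.max 0 (1 + ln (2 * K)))); first by rewrite mulr_gt0 // invr_gt0.
move=> L; rewrite ge_max => /andP[L0 LK].
pose t := expR (- L).
have t0 : 0 < t by exact: expR_gt0.
have t1 : t <= 1 by rewrite expR_le1 oppr_le0.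
have lt : - ln t = L by rewrite /t expRK opprK.
have t01 : 0 <= t <= 1 by rewrite ltW.
(* This follows from [expR L >= 1 + L]. *)
have Lt : L * t <= 1.
  have := expR_ge1Dx L; rewrite /t expRN -ler_pdivlMr ?invr_gt0 ?expR_gt0 //.
  by rewrite invrK mul1r; lra.
have /ent_estimate hent k : ln (eigval (w t) k) <= (eigval (w t) k - 1)
    - L * ((eigval (w t) k - 1) * (eigval (w t) k - 1)) + 4 * K ^+ 2 * L * t ^+ 4.
  rewrite -lt; apply: ln_le_quadratic => //; first by rewrite t0.
  - by rewrite lt.
  - exact: w_gt0.
  - exact: hK.
(* An inequality in [R[i]] combines equal imaginary parts with an inequality of real parts; only the
   latter is kept. *)
have := lsi _ (testX_psd t); rewrite dirichletE lecE => /andP[_].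
rewrite !ReZ => hlsi.
have /ler_normlP[h1' _] := h1 t t01.
have /ler_normlP[_ h2'] := h2 t t01.
have /ler_normlP[h3' _] := h3 t t01.
have /ler_normlP[_ h4'] := h4 t t01.
have /ler_normlP[_ h5'] := h5 t t01.
have t01' : 0 < t <= 1 by rewrite t0.
exact: (lsi_arithmetic a0 L0 t01' Lt C30 C40 h1' h2' h3' h4' h5' hent hlsi).
Qed.

End NoLogSobolev.

Theorem theorem5p1 (R : realType) (d : nat)
  (N : 'M[R[i]]_d -> Prop) (E : 'M[R[i]]_d -> 'M[R[i]]_d) (alpha : R) :
  star_subalgebra N ->
  (exists A, N A /\ forall c : R[i], A <> c%:M) ->
  (exists X, ~ N X) ->
  cond_expectation N E ->
  predual E ((d%:R)^-1 *: 1%:M) \in unitmx ->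
  0 <= alpha ->
  (forall X : 'M[R[i]]_d, psdmx X ->
     (alpha%:C)%C * ent2 (predual E ((d%:R)^-1 *: 1%:M)) E X
     <= dirichlet2 (predual E ((d%:R)^-1 *: 1%:M)) (lindbladian E) X) ->
  alpha = 0.
Proof.
move=> algN nontriv proper Econd us a0 lsi.
have [Elin E1 cp [EN EA] Emod] := Econd.
have Epos X : psdmx X -> psdmx (E X) by exact: completely_positive_psdmx.
have [p [Np pp hp p0 p1]] := subalg_projection algN nontriv.
have [Y0 nY0] := subalg_offdiag algN Np pp hp p0 p1 proper.
have Nq : N (1%:M - p) by apply: subalgB => //; exact: subalg1.
have qq : (1%:M - p) *m (1%:M - p) = 1%:M - p.
  by rewrite mulmxBr mulmx1 mulmxBl mul1mx pp subrr subr0.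
have [q qE] : exists q, 1%:M - p = q by exists (1%:M - p).
rewrite qE in nY0 Nq qq.
have hs : psdmx (predual E ((d%:R)^-1 *: 1%:M)).
  by apply: psdmx_predual => //; rewrite invr_ge0 ler0n.
have sp := predual_comm (d%:R)^-1 algN Econd Np.
(* Subtracting the conditional expectation lands in the kernel of [E] and stays in the corner, since
   [p] and [q] belong to [N]; the difference is nonzero because [q *m Y0 *m p] is not in [N]. *)
pose Y := q *m Y0 *m p - E (q *m Y0 *m p).
have EY : E Y = 0 by rewrite /Y (linED Elin) (linEN Elin) (EA _ (EN _)) subrr.
have Y_neq0 : Y != 0.
  by apply/eqP => /eqP; rewrite subr_eq0 => /eqP e; apply: nY0; rewrite e.
have qYp : (1%:M - p) *m Y *m p = Y.
  rewrite qE /Y (Emod _ _ _ Nq Np) -mulmxBl -mulmxBr; move: (Y0 - _) => V.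
  by rewrite !mulmxA qq -[_ *m p *m p]mulmxA pp.
apply: le_anti; rewrite a0 andbT.
exact: (no_lsi Elin E1 Epos (EA _ Np) (fun X => Emod p p X Np Np) EY Y_neq0 hs us
  pp hp sp qYp a0 lsi).
Qed.
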